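(* Let $k$ be an algebraically closed field of characteristic zero, $S=k[x_0,\dots,x_n]$, and let $X=\bigcup_{i=1}^{\ell}X_i\subset\mathbb{P}^n$ be a chain of projective varieties $X_1,\dots,X_\ell$, i.e. for $i\neq j$ one has $X_i\cap X_j\neq\emptyset$ if and only if $|i-j|=1$. Let $I_{X_i}\subset S$ be the saturated homogeneous ideal of $X_i$, and let $X$ be defined by the saturated homogeneous ideal $I_X=\bigcap_{i=1}^{\ell} I_{X_i}$. Suppose that the homogeneous coordinates $x_0,\dots,x_n$ and a sequence of integers $n_0=0<n_1<\cdots<n_\ell=n$ satisfy $$X_i\subset\{x_0=\cdots=x_{n_{i-1}-1}=0,\ x_{n_i+1}=x_{n_i+2}=\cdots=x_n=0\},\qquad i=1,\dots,\ell.$$ Let $\rho:\mathbb{G}_m\to\mathrm{GL}_{n+1}$ be a 1-parameter subgroup diagonalized by $\{x_0,\dots,x_n\}$ with weights $(r_0,\dots,r_n)\in\mathbb{Z}^{n+1}$, and let $\rho_i$ be the restriction of $\rho$ to $\mathrm{GL}(kx_{n_{i-1}}+\cdots+kx_{n_i})$, with weights $(r_{n_{i-1}},\dots,r_{n_i})$. Let $P$ be the Hilbert polynomial of $I_X\subset S$ (that is, of $S/I_X$) and let $P_i$ be the Hilbert polynomial of $I_{X_i}\cap k[x_{n_{i-1}},\dots,x_{n_i}]$ regarded as an ideal in $k[x_{n_{i-1}},\dots,x_{n_i}]$ (that is, of the corresponding quotient ring). Let $m$ be an integer which is at least the Gotzmann number of $P$ and of each $P_i$. Then the Hilbert–Mumford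 index $\mu([X]_m^*,\rho)$ of the dual $m$th Hilbert point of $X$ with respect to $\rho$ is given by $$\mu([X]_m^*,\rho)=\sum_{i=1}^{\ell}\mu([X_i]_m^*,\rho_i)-\sum_{i=1}^{\ell}\left(\frac{mP_i(m)}{n_i-n_{i-1}+1}\sum_{j=n_{i-1}}^{n_i}r_j\right)+\frac{mP(m)}{n+1}\sum_{i=0}^{n}r_i+m\sum_{i=1}^{\ell-1}r_{n_i}.$$
   Context: Dual Hilbert point. Let $0\le a\le b\le n$, $A=k[x_a,\dots,x_b]$, and let $J\subset A$ be a homogeneous ideal; $A_m,J_m$ denote degree $m$ pieces and $p=\dim_k A_m/J_m$. The dual $m$th Hilbert point $[J]_m^*$ is the quotient $A_m\to A_m/J_m$ viewed as a point of $\mathbb{P}(\bigwedge^{p}A_m^* )$, namely the line $\bigwedge^{p}(A_m/J_m)^*\subset\bigwedge^{p}A_m^*$. Let $f_a,\dots,f_b$ be the basis of $A_1^*$ dual to $x_a,\dots,x_b$ and $f^\alpha=\prod f_i^{\alpha_i}$. The wedge $f^{\alpha(1)}\wedge\cdots\wedge f^{\alpha(p)}$ occurs with nonzero Plücker coordinate in $[J]_m^*$ if and only if $x^{\alpha(1)},\dots,x^{\alpha(p)}$ form a $k$-basis of $A_m/J_m$. Notation. $[X]_m^*$ denotes $[I_X]_m^*$ (with $A=S$), and $[X_i]_m^*$ denotes $[I_{X_i}\cap k[x_{n_{i-1}},\dots,x_{n_i}]]_m^*$ (with $A=k[x_{n_{i-1}},\dots,x_{n_i}]$). Hilbert–Mumford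 index. The weights of a 1-parameter subgroup $\sigma$ with weights $(r_a,\dots,r_b)$ are taken with respect to the action on the space in which the dual Hilbert points live, i.e. $\sigma(t).f_i=t^{r_i}f_i$, so that $f^\alpha$ has weight $\sum_i\alpha_ir_i$. The index is computed after replacing $\sigma$ by the associated 1-parameter subgroup of the special linear group with (rational) weights $r_i'=r_i-\bar r$, where $\bar r=\frac{1}{b-a+1}\sum_{i=a}^{b}r_i$, and is the maximum of the negatives of the weights of the states: $$\mu([J]_m^*,\sigma)=\max\Bigl\{-\sum_{x^\alpha\in\mathcal{B}}\sum_{i=a}^{b}\alpha_ir_i'\ :\ \mathcal{B}\text{ a set of degree } m \text{ monomials of } A \text{ forming a } k\text{-basis of } A_m/J_m\Bigr\}.$$ *)

(* Defs.v *)
From HB Require Import structures.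
From Stdlib Require Import ClassicalEpsilon.
From mathcomp Require Import all_boot all_order all_algebra.
From mathcomp Require Export mpoly.

Set Implicit Arguments.
Unset Strict Implicit.
Unset Printing Implicit Defensive.

Import Order.TTheory GRing.Theory Num.Theory.
Local Open Scope ring_scope.

Section Geometry.
Variables (k : closedFieldType) (n : nat).
Local Notation S := {mpoly k[n.+1]}.
Local Notation pt := 'rV[k]_n.+1.

(* A subset of P^n is given by the set of all homogeneous coordinate vectors of
   its points; closed subsets consist of nonzero vectors and are stable under
   scaling because their equations are homogeneous. *)
Definition zariski_closed (X : pt -> Prop) : Prop :=
  exists T : S -> Prop,
    (forall f, T f -> exists d : nat, f \is d.-homog) /\
    (forall v : pt, X v <-> v != 0 /\ forall f, T f -> f.@[v ord0] = 0).

(* Varieties are reduced, and are not required to be irreducible; statements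
   about them therefore apply a fortiori to irreducible varieties. *)
Definition projective_variety (X : pt -> Prop) : Prop :=
  zariski_closed X /\ exists v, X v.

(* The homogeneous ideal generated by the homogeneous polynomials vanishing on
   X, i.e. the polynomials all of whose homogeneous components vanish on X.
   For X closed and nonempty this is the saturated ideal of X with its reduced
   structure. *)
Definition vanishing_ideal (X : pt -> Prop) (f : S) : Prop :=
  forall (d : nat) (v : pt), X v -> (pihomog mdeg d f).@[v ord0] = 0.

(* I_X for the union X of the X i. *)
Definition union_ideal (l : nat) (X : 'I_l -> pt -> Prop) (f : S) : Prop :=
  forall i, vanishing_ideal (X i) f.

(* k[x_a, ..., x_b] as a subring of k[x_0, ..., x_n]. *)
Definition subring (a b : nat) (f : S) : Prop :=
  forall al : 'X_{1..n.+1}, al \in msupp f ->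
  forall i : 'I_n.+1, al i != 0%N -> (a <= i <= b)%N.

Definition contraction (a b : nat) (I : S -> Prop) (f : S) : Prop :=
  I f /\ subring a b f.

(* e represents a k-basis of A_m / J_m, where A = k[x_a, ..., x_b].  Linear
   independence is that of the family, so e has no repetition. *)
Definition quotient_basis (a b m : nat) (J : S -> Prop) (e : seq S) : Prop :=
  [/\ forall f, f \in e -> f \is m.-homog /\ subring a b f,
      forall c : 'I_(size e) -> k,
        J (\sum_(i < size e) c i *: e`_i) -> forall i, c i = 0
    & forall f, f \is m.-homog -> subring a b f ->
        exists c : 'I_(size e) -> k, J (f - \sum_(i < size e) c i *: e`_i)].

(* P is the Hilbert polynomial of k[x_a, ..., x_b] / J. *)
Definition hilbert_polynomial (a b : nat) (J : S -> Prop) (P : {poly rat}) :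
    Prop :=
  exists m0 : nat, forall m : nat, (m0 <= m)%N ->
    exists2 e : seq S, quotient_basis a b m J e & P.[m%:R] = (size e)%:R.

Definition mean_weight (a b : nat) (r : 'I_n.+1 -> int) : rat :=
  (\sum_(i < n.+1 | (a <= i <= b)%N) (r i)%:~R) / (b - a + 1)%:R.

(* w is the negative of the normalized weight of a state of the dual m-th
   Hilbert point of J, i.e. of a set B of monomials forming a basis of
   A_m / J_m. *)
Definition state_weight (a b m : nat) (J : S -> Prop) (r : 'I_n.+1 -> int)
    (w : rat) : Prop :=
  exists2 B : seq 'X_{1..n.+1},
    quotient_basis a b m J [seq 'X_[al] | al <- B]
    & w = - \sum_(al <- B) \sum_(i < n.+1 | (a <= i <= b)%N)
              (al i)%:R * ((r i)%:~R - mean_weight a b r).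

Definition is_max (E : rat -> Prop) (w : rat) : Prop :=
  E w /\ forall v, E v -> v <= w.

(* The maximum exists when J is a homogeneous ideal of A: the finitely many
   monomials of degree m span A_m, so some set of them is a basis of
   A_m / J_m. *)
Definition hm_index (a b m : nat) (J : S -> Prop) (r : 'I_n.+1 -> int) : rat :=
  epsilon (inhabits 0) (is_max (state_weight a b m J r)).

End Geometry.

(* The polynomial binomial(t + c, a) in t. *)
Definition binomial_poly (c : int) (a : nat) : {poly rat} :=
  (a`!%:R)^-1 *: \prod_(j < a) ('X + (c - j%:Z)%:~R%:P).

(* g is the number of terms of the Gotzmann representation
     P(t) = binomial(t + a_1, a_1) + binomial(t + a_2 - 1, a_2) + ...
            + binomial(t + a_g - (g - 1), a_g),   a_1 >= ... >= a_g >= 0,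
   which is unique, and exists for every Hilbert polynomial. *)
Definition gotzmann_number (P : {poly rat}) (g : nat) : Prop :=
  exists a : seq nat,
    [/\ size a = g, sorted geq a
      & P = \sum_(i < g) binomial_poly ((nth 0%N a i)%:Z - i%:Z) (nth 0%N a i)].

(* Main.v *)
Require Import Defs.
From Stdlib Require Import ClassicalEpsilon.
From mathcomp Require Import all_boot all_order all_algebra.
From mathcomp Require Import zify ring.

Set Implicit Arguments.
Unset Strict Implicit.
Unset Printing Implicit Defensive.

Import Order.TTheory GRing.Theory Num.Theory.
Local Open Scope ring_scope.

(** Two facts make the formula true: a description of the monomial bases of
    S_m / I_X in terms of those of the components, and a theorem on Hilbert
    functions that turns the number of elements of such a basis into a value of
    the Hilbert polynomial.

    Monomials.  The linear spans of consecutive components meet in a single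
    coordinate point, where only the variable x_(n_i) survives.  Hence a
    monomial whose support lies in none of the intervals [n_(i-1), n_i]
    vanishes on X, and the node powers x_(n_i)^m, 0 < i < l, are the only
    monomials of degree m that live on two components.  Evaluation at the
    coordinate point kills every monomial of degree m but the node power, so
    every monomial basis attached to X, X_i or X_(i+1) contains it.
    Consequently a monomial basis for X restricts to monomial bases for the
    components ([monomial_basis_restrict]), any choice of bases for the
    components glues ([monomial_basis_glue]), and weights add up except that
    each node power is counted twice ([total_weight_restrict]).  The index is
    read off a basis of least total weight ([hm_index_lightest]), so lightest
    bases correspond to lightest bases, and the node powers give the term
    m (r_(n_1) + ... + r_(n_(l-1))).  Passing to the special linear group adds
    to each index m times the size of a basis times the mean weight.

    Hilbert functions.  These sizes are P(m) and P_i(m) as soon as m is at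
    least the Gotzmann number ([hilbert_function_eq_polynomial]).  Let H be the
    Hilbert function of a set of points Y, with Hilbert polynomial P of
    Gotzmann number g.  Macaulay's growth theorem says that if H(d+1) reaches
    the value at d+1 of a Gotzmann representation, then so does H(d) at d
    ([macaulay_quotient]).  Descending from a large degree, where H = P, gives
    P(d) <= H(d) for d >= g.  For the other inequality, choose a linear form h
    that vanishes at none of finitely many points of Y which detect the
    vanishing on Y in all the degrees at stake.  Multiplication by h is then
    injective in these degrees, so H(d+1) - H(d) is the Hilbert function of the
    quotient by h.  Macaulay's theorem for this quotient bounds the increments
    of H below by those of P, whence H(d) <= P(d) by descent once more.

    Macaulay's theorem.  Standard monomials for a monomial order have their
    shadow among the standard monomials of one degree less, so the theorem
    becomes a statement on finite sets of monomials ([macaulay_shadow]).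
    Compressing them in pairs of variables makes such a set C stable under
    replacing any variable by the first one, p ([stabilize]).  For a stable set
    the shadow is the colon set of C by x_p, and an induction on the number of
    variables proves together Macaulay's bound and Green's bound, which
    compares a stable set with its monomials free of x_p ([macaulay_step],
    [green_bound]). *)

(** * Values of Gotzmann representations *)

(** The value at [d] of the polynomial with Gotzmann representation [s], that
    is the sum of the binomials C(d - i + s_i, s_i), where the terms of index
    larger than [d] are dropped.  With this truncation the bounds of Green and
    Macaulay below hold for sequences [s] of any length. *)
Fixpoint gotzmann_sum (s : seq nat) (d : nat) : nat :=
  match s, d with
  | [::], _ => 0
  | _ :: _, 0 => 1
  | a :: s', d'.+1 => 'C(d'.+1 + a, a) + gotzmann_sum s' d'
  end.

Lemma gotzmann_sum_mapS0 s : gotzmann_sum (map S s) 0 = gotzmann_sum s 0.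
Proof. by case: s. Qed.

(** Pascal's rule, term by term.  Restriction to a hyperplane turns a polynomial
    into its difference, that is, it lowers the entries of the representation. *)
Lemma gotzmann_sum_mapS s d :
  gotzmann_sum (map S s) d.+1 = (gotzmann_sum s d.+1 + gotzmann_sum (map S s) d)%N.
Proof.
elim: s d => [|a s IH] [|d] //=.
  by rewrite gotzmann_sum_mapS0 !addSn !add0n !binSn; lia.
rewrite IH /=.
have -> : (d.+2 + a.+1 = (d.+1 + a.+1).+1)%N by lia.
rewrite binS; have -> : (d.+1 + a.+1 = d.+2 + a)%N by lia.
lia.
Qed.

Lemma gotzmann_sum_zeros s z d :
  gotzmann_sum (s ++ nseq z 0%N) d = (gotzmann_sum s d + minn z (d.+1 - size s))%N.
Proof.
elim: s d => [|a s IH] [|d] /=.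
- by case: z => [|z] //=; lia.
- elim: z d => [|z IHz] d /=; first by lia.
  rewrite addn0 bin0; case: d => [|d]; last by rewrite IHz; lia.
  by case: z {IHz} => [|z] /=; lia.
- by lia.
- by rewrite IH; lia.
Qed.

Lemma gotzmann_sum_cat1 s d :
  gotzmann_sum (s ++ [:: 1%N]) d = (gotzmann_sum s d + (d.+1 - size s))%N.
Proof.
elim: s d => [|a s IH] [|d] //=; first by rewrite addn1 bin1; lia.
by rewrite IH; lia.
Qed.

(** Taking differences lowers the nonzero entries of a Gotzmann representation
    and drops the zeros, provided none of them is truncated. *)
Lemma gotzmann_sum_diff b z d : (size b + z <= d.+1)%N ->
  gotzmann_sum (map S b ++ nseq z 0%N) d.+1 =
  (gotzmann_sum (map S b ++ nseq z 0%N) d + gotzmann_sum b d.+1)%N.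
Proof. by move=> sz; rewrite !gotzmann_sum_zeros gotzmann_sum_mapS size_map; lia. Qed.

(** Nonincreasing sequences are the raised ones followed by zeros.  The last
    clause keeps [b ++ [:: 0]] available as a Gotzmann representation: its value
    is one more than that of [b]. *)
Lemma sorted_mapS_zeros s : sorted geq s ->
  exists b z, [/\ s = map S b ++ nseq z 0%N, sorted geq b
                & sorted geq (b ++ [:: 0%N])].
Proof.
elim: s => [|a s IH] /=; first by exists [::], 0%N.
rewrite path_sortedE; last by move=> x y z; rewrite /geq /=; lia.
case/andP=> /allP as_ /IH [b [z [E sb sb0]]].
case: a as_ => [|a] as_.
  exists [::], (size s).+1; split=> //=; congr (_ :: _).
  apply/all_pred1P/allP=> x /as_ /=; rewrite /geq /=; case: x => //.
have ab x : x \in b -> (x <= a)%N.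
  move=> xb; have := as_ x.+1; rewrite E mem_cat (map_f S xb) /= /geq /=.
  by move/(_ isT).
have tr : transitive geq by move=> x y w; rewrite /geq /=; lia.
exists (a :: b), z; split=> /=; first by rewrite E.
- rewrite path_sortedE // sb andbT; apply/allP=> x /ab; rewrite /geq /=; lia.
- rewrite path_sortedE // sb0 andbT; apply/allP=> x.
  by rewrite mem_cat inE => /orP[/ab|/eqP->]; rewrite /geq /=; lia.
Qed.

(** * Compression of sets of monomials in two variables *)

(** Monomials of degree [t] in two variables, given by one exponent: a set [s]
    other than all of [0, t] has a shadow at least as large as itself, because
    at a missing exponent one can switch from lowering one variable to lowering
    the other. *)
Lemma minn_size_shadow (s s2 : seq nat) t :
  uniq s -> (forall x, x \in s -> (x <= t)%N) ->
  (forall x, x \in s -> (x < t)%N -> x \in s2) ->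
  (forall x, x \in s -> (0 < x)%N -> x.-1 \in s2) ->
  (minn (size s) t <= size s2)%N.
Proof.
move=> us st up down.
case: (boolP (all (mem s) (iota 0 t.+1))) => [/allP full|/allPn[x]].
  apply: (leq_trans (geq_minr _ _)); rewrite -{1}(size_iota 0 t).
  apply: uniq_leq_size (iota_uniq _ _) _ => x; rewrite mem_iota add0n /= => xt.
  by apply: up => //; apply: full; rewrite mem_iota; lia.
rewrite mem_iota add0n ltnS /= => xt xs.
apply: (leq_trans (geq_minl _ _)).
(* lower the first variable below the gap [x] and the second one above it *)
pose f y := if (y < x)%N then y else y.-1.
rewrite -(size_map f); apply: uniq_leq_size.
  rewrite map_inj_in_uniq // => y z ys zs; rewrite /f.
  have yx : y != x by apply: contraNneq xs => <-.
  have zx : z != x by apply: contraNneq xs => <-.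
  by move/eqP: yx; move/eqP: zx; case: (ltnP y x) => ?; case: (ltnP z x) => ? ? ? ?; lia.
move=> z /mapP[y ys ->]; rewrite /f.
have yx : y != x by apply: contraNneq xs => <-.
by move/eqP: yx; case: ltnP => ? ?; [apply: up => //; lia | apply: down => //; lia].
Qed.

(** Initial segments minimise the sum of the elements, strictly so for a set
    with a gap; this makes compression terminate.  Induction on a bound, since
    the largest element is at least the size minus one. *)
Lemma sum_iota_le_lt n (s : seq nat) : uniq s -> (forall x, x \in s -> (x < n)%N) ->
  (\sum_(x <- iota 0 (size s)) x <= \sum_(x <- s) x)%N /\
  ((exists y, [/\ y \in s, (0 < y)%N & y.-1 \notin s]) ->
    (\sum_(x <- iota 0 (size s)) x < \sum_(x <- s) x)%N).
Proof.
elim: n s => [|n IH] s us sn.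
  by case: s us sn => [|x s] us sn; [split=> // -[y []] | have := sn x (mem_head _ _)].
have [ns|ns] := boolP (n \in s); last first.
  apply: IH => // x xs; have := sn x xs; rewrite ltnS leq_eqVlt => /orP[/eqP E|//].
  by rewrite -E xs in ns.
have ps := perm_to_rem ns.
have ur : uniq (rem n s) by rewrite rem_uniq.
have rn x : x \in rem n s -> (x < n)%N.
  rewrite mem_rem_uniq // !inE => /andP[xn /sn]; lia.
have rsz : (size (rem n s) <= n)%N.
  rewrite -[X in (_ <= X)%N](size_iota 0 n); apply: uniq_leq_size => // x /rn.
  by rewrite mem_iota.
have [le _] := IH _ ur rn.
have -> : (\sum_(x <- s) x = n + \sum_(x <- rem n s) x)%N.
  by rewrite (perm_big _ ps) big_cons.
have -> : (\sum_(x <- iota 0 (size s)) x =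
           size (rem n s) + \sum_(x <- iota 0 (size (rem n s))) x)%N.
  by rewrite (perm_size ps) -[size (_ :: _)]addn1 iotaD big_cat big_seq1 add0n addnC.
split; first exact: leq_add rsz le.
case=> y [ys y0 ys']; rewrite -addSn; apply: leq_add le.
have : (size (y.-1 :: rem n s) <= size (iota 0 n))%N; last by rewrite size_iota.
apply: uniq_leq_size => [|x].
  by rewrite /= ur andbT; apply: contra ys' => /mem_rem.
rewrite mem_iota inE => /orP[/eqP->|/rn //].
by have := sn y ys; lia.
Qed.

Lemma big_class (I K : eqType) (h : I -> K) (ks : seq K) (C : seq I) (F : I -> nat) :
  uniq ks -> (forall u, u \in C -> h u \in ks) ->
  (\sum_(u <- C) F u = \sum_(w <- ks) \sum_(u <- C | h u == w) F u)%N.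
Proof.
move=> uk hk; rewrite (exchange_big_dep predT) //=; apply: eq_big_seq => u uC.
rewrite (big_rem (h u)) ?hk //= eqxx big_seq_cond big_pred0 ?addn0 // => w.
by rewrite mem_rem_uniq // inE eq_sym; case: eqP => //= _; rewrite andbF.
Qed.

Section Compression.
Variables (N : nat) (p j : 'I_N).
Hypothesis pj : p != j.
Local Notation mon := 'X_{1..N}.
Implicit Types (C B : seq mon) (u v w : mon).

(** The part of a monomial that compression in [p], [j] leaves unchanged. *)
Definition others u : mon :=
  [multinom if (i == p) || (i == j) then 0%N else u i | i < N].

Definition fiber C w := [seq v <- C | others v == w].

(** Inverse, on the monomials of degree [d], of the coordinates given by
    [others] and the [j]-exponent. *)
Definition segment_mon d w s : mon :=
  (w + (U_(j) *+ s + U_(p) *+ (d - mdeg w - s)))%MM.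

(** In each fiber, the same number of monomials, now those with the smallest
    [j]-exponents, hence the largest [p]-exponents. *)
Definition compress d C : seq mon :=
  [seq segment_mon d w s
     | w <- undup (map others C), s <- iota 0 (size (fiber C w))].

Lemma othersE u i :
  others u i = if (i == p) || (i == j) then 0%N else u i.
Proof. by rewrite mnmE. Qed.

Lemma othersK u : u = (others u + (U_(j) *+ u j + U_(p) *+ u p))%MM.
Proof.
apply/mnmP=> i; rewrite !mnmDE othersE !mulmnE !mnm1E.
case: (eqVneq i p) => [->|ip] /=.
  by rewrite [j == p]eq_sym (negbTE pj) mul0n mul1n.
case: (eqVneq i j) => [->|ij] /=.
  by rewrite mul0n mul1n addn0.
by rewrite !mul0n !addn0.
Qed.

Lemma mdeg_others u : mdeg u = (mdeg (others u) + (u j + u p))%N.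
Proof. by rewrite [in LHS](othersK u) !mdegD !mdegMn !mdeg1 !mul1n. Qed.

Lemma others_id u : others (others u) = others u.
Proof. by apply/mnmP=> i; rewrite !othersE; case: (_ || _). Qed.

Lemma others_segment d w s : others w = w -> others (segment_mon d w s) = w.
Proof.
move=> ow; rewrite -[RHS]ow; apply/mnmP=> i; rewrite !othersE.
case: ifP => // /norP[ip ij].
by rewrite !mnmDE !mulmnE !mnm1E ![_ == i]eq_sym (negbTE ip) (negbTE ij) !mul0n !addn0.
Qed.

Lemma segment_j d w s : others w = w -> segment_mon d w s j = s.
Proof.
move=> ow; rewrite !mnmDE !mulmnE !mnm1E eqxx (negbTE pj) mul0n mul1n addn0.
by rewrite -ow othersE eqxx orbT.
Qed.

Lemma fiber_mono d w u : mdeg u = d -> others u = w -> u = segment_mon d w (u j).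
Proof.
move=> <- <-; rewrite [LHS]othersK /segment_mon; congr (_ + (_ + _ *+ _))%MM.
by rewrite (mdeg_others u); lia.
Qed.

Section Degree.
Variables (d : nat) (C : seq mon).
Hypothesis dC : forall u, u \in C -> mdeg u = d.

Definition exponents w := [seq v j | v : mon <- fiber C w].

Lemma mem_exponents w s : others w = w ->
  (s \in exponents w) = (segment_mon d w s \in C) && (s <= d - mdeg w)%N.
Proof.
move=> ow; apply/mapP/andP => [[v]|[sC sd]].
  rewrite mem_filter => /andP[/eqP ov vC] ->.
  by rewrite -(fiber_mono (dC vC) ov); split=> //; rewrite -(dC vC) mdeg_others ov; lia.
exists (segment_mon d w s); last by rewrite segment_j.
by rewrite mem_filter sC others_segment ?eqxx.
Qed.

Lemma exponents_le w s : s \in exponents w -> (mdeg w + s <= d)%N.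
Proof.
case/mapP=> v; rewrite mem_filter => /andP[/eqP <- vC] ->.
by rewrite -(dC vC) (mdeg_others v); lia.
Qed.

Hypothesis uC : uniq C.

Lemma exponents_uniq w : uniq (exponents w).
Proof.
rewrite map_inj_in_uniq ?filter_uniq // => u v.
rewrite !mem_filter => /andP[/eqP ou uC'] /andP[/eqP ov vC] E.
by rewrite (fiber_mono (dC uC') ou) (fiber_mono (dC vC) ov) E.
Qed.

Lemma fiber_size w : (0 < size (fiber C w))%N ->
  (mdeg w + size (fiber C w) <= d.+1)%N.
Proof.
rewrite -(size_map (fun v : mon => v j)) -/(exponents w) => s0.
have wd : (mdeg w <= d)%N.
  case E: (exponents w) s0 => [//|x s] _.
  by have := @exponents_le w x; rewrite E mem_head; lia.
have : (size (exponents w) <= size (iota 0 (d.+1 - mdeg w)))%N;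
  last by rewrite size_iota; lia.
by apply: uniq_leq_size (exponents_uniq w) _ => s /exponents_le; rewrite mem_iota; lia.
Qed.

Lemma mem_keys w : (w \in undup (map others C)) = (0 < size (fiber C w))%N.
Proof.
rewrite mem_undup -has_predT has_filter; apply/mapP/idP.
  case=> u uC' ->; rewrite -has_filter; apply/hasP; exists u => //.
  by rewrite mem_filter eqxx.
rewrite -has_filter => /hasP[u]; rewrite mem_filter => /andP[/eqP <- uC'] _.
by exists u.
Qed.

Lemma key_others w : w \in undup (map others C) -> others w = w.
Proof. by rewrite mem_undup => /mapP[u _ ->]; rewrite others_id. Qed.

Lemma mem_compress u :
  (u \in compress d C) =
  (mdeg u == d) && (u j < size (fiber C (others u)))%N.
Proof.
apply/allpairsPdep/andP => [[w [s [wk sw ->]]]|[/eqP du lu]].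
  have ow := key_others wk; move: wk; rewrite mem_keys => /fiber_size.
  move: sw; rewrite mem_iota add0n /= => sw ws.
  rewrite segment_j // others_segment // sw; split=> //.
  rewrite !mdegD !mdegMn !mdeg1 !mul1n; lia.
exists (others u), (u j); rewrite mem_keys mem_iota; split=> //; first by lia.
exact: fiber_mono.
Qed.

Lemma compress_uniq : uniq (compress d C).
Proof.
apply: allpairs_uniq_dep (undup_uniq _) _ _ => [w _|]; first exact: iota_uniq.
move=> [w s] [w' s'] /allpairsPdep[a [b [ak _ [-> ->]]]].
move=> /allpairsPdep[a' [b' [ak' _ [-> ->]]]] /= E.
have oa := key_others ak; have oa' := key_others ak'.
have Ea : a = a' by rewrite -(others_segment d b oa) E others_segment.
have Eb : b = b' by rewrite -(segment_j d b oa) E segment_j.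
by rewrite Ea Eb.
Qed.

Lemma compress_sum (F : mon -> nat) :
  (\sum_(u <- compress d C) F u =
   \sum_(w <- undup (map others C)) \sum_(s <- iota 0 (size (fiber C w)))
      F (segment_mon d w s))%N.
Proof. by rewrite big_allpairs_dep. Qed.

Lemma sum_fibers (F : mon -> nat) :
  (\sum_(u <- C) F u =
   \sum_(w <- undup (map others C)) \sum_(s <- exponents w) F (segment_mon d w s))%N.
Proof.
rewrite [LHS](big_class (h := others) (ks := undup (map others C)))
  ?undup_uniq //; last first.
  by move=> u uC'; rewrite mem_undup map_f.
apply: eq_big_seq => w _; rewrite /exponents big_map /fiber big_filter.
rewrite big_seq_cond [RHS]big_seq_cond; apply: eq_bigr => u /andP[uC' /eqP ou].
by rewrite -fiber_mono // dC.
Qed.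

Lemma compress_size : size (compress d C) = size C.
Proof.
rewrite -!sum1_size compress_sum sum_fibers; apply: eq_bigr => w _.
by rewrite !sum1_size size_iota size_map.
Qed.

End Degree.

End Compression.

(** * Shadows and stable sets *)

Section Shadow.
Variable N : nat.
Local Notation mon := 'X_{1..N}.
Implicit Types (C B : seq mon) (u v w : mon).

(** A bound on the lower shadow rather than the shadow itself, so that [C] and
    [B] can be compressed simultaneously. *)
Definition shadow_in C B :=
  forall u (i : 'I_N), u \in C -> (0 < u i)%N -> (u - U_(i))%MM \in B.

Definition stable (p : 'I_N) C :=
  forall u (j : 'I_N), u \in C -> j != p -> (0 < u j)%N ->
  (u - U_(j) + U_(p))%MM \in C.

Definition homog_monomials d C := uniq C /\ forall u, u \in C -> mdeg u = d.

Definition supported_from (p : nat) C :=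
  forall u (i : 'I_N), u \in C -> (i < p)%N -> u i = 0%N.

Definition height (p : 'I_N) C := (\sum_(u <- C) (mdeg u - u p))%N.

Lemma mnm1_le (i : 'I_N) u : (0 < u i)%N -> (U_(i) <= u)%MM.
Proof. by move=> ui; apply/mnm_lepP=> k; rewrite mnm1E; case: eqP => // <-. Qed.

Lemma mdeg_sub_mnm1 d (i : 'I_N) u :
  mdeg u = d.+1 -> (0 < u i)%N -> mdeg (u - U_(i))%MM = d.
Proof.
move=> du ui; have := congr1 mdeg (submK (mnm1_le ui)).
by rewrite mdegD mdeg1 du; lia.
Qed.

Section Pair.
Variables (p j : 'I_N).
Hypothesis pj : p != j.

Lemma segment_addp d w s : (s + mdeg w <= d)%N ->
  segment_mon p j d.+1 w s = (segment_mon p j d w s + U_(p))%MM.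
Proof.
move=> sd; rewrite /segment_mon -!addmA; congr (_ + (_ + _))%MM.
have -> : (d.+1 - mdeg w - s = (d - mdeg w - s).+1)%N by lia.
by rewrite mulmS addmC.
Qed.

Lemma segment_addj d w s :
  segment_mon p j d.+1 w s.+1 = (segment_mon p j d w s + U_(j))%MM.
Proof.
rewrite /segment_mon -!addmA; congr (_ + _)%MM.
have -> : (d.+1 - mdeg w - s.+1 = d - mdeg w - s)%N by lia.
by rewrite mulmS [(U_(j) + _)%MM]addmC -addmA [(U_(j) + _)%MM]addmC.
Qed.

(** Compression does not create new shadow.  Removing another variable maps
    fibers injectively into fibers; removing [p] or [j] stays within one fiber,
    where [minn_size_shadow] counts. *)
Lemma compress_shadow d C B : homog_monomials d.+1 C -> homog_monomials d B ->
  shadow_in C B -> shadow_in (compress p j d.+1 C) (compress p j d B).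
Proof.
move=> [uC dC] [uB dB] sh u i.
rewrite !mem_compress // => /andP[/eqP du ltu] ui.
rewrite (mdeg_sub_mnm1 du ui) eqxx /=; set w := others p j u in ltu *.
have ow : others p j w = w by rewrite others_id.
have [ipj|ipj] := boolP ((i == p) || (i == j)).
  have -> : others p j (u - U_(i))%MM = w.
    apply/mnmP=> k; rewrite !othersE; case: ifP => // /norP[kp kj].
    rewrite mnmBE mnm1E; case: eqP => [E|_]; last by rewrite subn0.
    by move: ipj; rewrite E (negbTE kp) (negbTE kj).
  have mw := mdeg_others pj u; rewrite -/w du in mw.
  suff key : (minn (size (exponents p j C w)) (d.+1 - mdeg w)
              <= size (exponents p j B w))%N.
    rewrite !size_map in key; apply: leq_trans key; rewrite mnmBE mnm1E leq_min.
    case/orP: ipj => /eqP E; move: ui; rewrite E => ui.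
      by rewrite (negbTE pj) subn0; apply/andP; split=> //; lia.
    by rewrite eqxx; apply/andP; split; lia.
  apply: minn_size_shadow.
  - exact: (exponents_uniq pj dC uC).
  - by move=> x /(exponents_le pj dC); lia.
  - move=> x; rewrite (mem_exponents pj dC) // => /andP[xC _] xt.
    rewrite (mem_exponents pj dB) //; apply/andP; split; last by lia.
    have xd : (x + mdeg w <= d)%N by lia.
    move: (sh _ p xC); rewrite segment_addp // addmK mnmDE mnm1E eqxx.
    by apply; rewrite addn1.
  - case=> // x; rewrite (mem_exponents pj dC) // => /andP[xC xd] _ /=.
    rewrite (mem_exponents pj dB) //; apply/andP; split; last by lia.
    move: (sh _ j xC); rewrite segment_addj addmK mnmDE mnm1E eqxx.
    by apply; rewrite addn1.
case/norP: (ipj) => ip ij.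
have -> : (u - U_(i))%MM j = u j by rewrite mnmBE mnm1E (negbTE ij) subn0.
apply: (leq_trans ltu); rewrite -(size_map (fun v => (v - U_(i))%MM)).
have pos v : v \in fiber p j C w -> (0 < v i)%N.
  rewrite mem_filter => /andP[/eqP E _]; move: ui.
  have := congr1 (fun x : mon => x i) E; rewrite !othersE (negbTE ip) (negbTE ij) /=.
  by move=> ->.
apply: uniq_leq_size.
  rewrite map_inj_in_uniq ?filter_uniq // => v v' vC vC' E.
  by rewrite -(submK (mnm1_le (pos _ vC))) E submK // mnm1_le // pos.
move=> x /mapP[v vC ->]; move: (pos _ vC) (vC); rewrite !mem_filter.
move=> vi /andP[/eqP E vC']; rewrite sh // andbT; apply/eqP/mnmP=> k.
have := congr1 (fun x : mon => x k) E; rewrite /w !othersE.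
by case: ifP => // _; rewrite !mnmBE => ->.
Qed.

Lemma compress_support d C (q : nat) : homog_monomials d C -> (q <= p)%N -> (q <= j)%N ->
  supported_from q C -> supported_from q (compress p j d C).
Proof.
move=> [uC dC] qp qj sC u i; rewrite mem_compress // => /andP[_ lt] iq.
have : has predT (fiber p j C (others p j u)) by rewrite has_predT; apply: leq_ltn_trans lt.
case/hasP=> v; rewrite mem_filter => /andP[/eqP E vC] _.
have := congr1 (fun x : mon => x i) E; rewrite !othersE.
case: eqP => [E'|_] /=; first by rewrite E' ltnNge qp in iq.
case: eqP => [E'|_] /=; first by rewrite E' ltnNge qj in iq.
by move=> <-; exact: sC.
Qed.

Lemma height_segment d w s : others p j w = w ->
  (mdeg (segment_mon p j d w s) - segment_mon p j d w s p = mdeg w + s)%N.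
Proof.
move=> ow; rewrite (mdeg_others pj) others_segment // segment_j //; lia.
Qed.

Lemma compress_height d C : homog_monomials d C ->
  (exists2 u, u \in C & (0 < u j)%N && ((u - U_(j) + U_(p))%MM \notin C)) ->
  (height p (compress p j d C) < height p C)%N.
Proof.
move=> [uC dC] [u uinC /andP[uj unC]]; rewrite /height.
rewrite (compress_sum p j d C) (sum_fibers pj dC).
have split w (s : seq nat) : w \in undup (map (others p j) C) ->
  (\sum_(x <- s) (mdeg (segment_mon p j d w x) - segment_mon p j d w x p) =
   size s * mdeg w + \sum_(x <- s) x)%N.
  move=> wk; have ow := key_others wk.
  rewrite (eq_bigr (fun x => mdeg w + x)%N) => [|x _]; last by rewrite height_segment.
  by rewrite big_split /= big_const_seq count_predT iter_addn_0 mulnC.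
set ks := undup _; have uk : others p j u \in ks by rewrite mem_undup map_f.
have bound w x : x \in exponents p j C w -> (x < d.+1)%N.
  by move/(exponents_le pj dC); lia.
rewrite (big_rem _ uk) /= [X in (_ < X)%N](big_rem _ uk) /= -addSn.
apply: leq_add.
  rewrite !split // size_iota size_map ltn_add2l -(size_map (fun v : mon => v j)).
  have [_] := sum_iota_le_lt (exponents_uniq pj dC uC _) (bound (others p j u)).
  apply; exists (u j); split=> //.
    by apply/mapP; exists u => //; rewrite mem_filter eqxx.
  rewrite (mem_exponents pj dC) ?others_id //; apply: contra unC => /andP[sC _].
  have E := fiber_mono pj (dC _ uinC) (erefl (others p j u)).
  have du : (mdeg (others p j u) + u j <= d)%N.
    by rewrite -(dC _ uinC) (mdeg_others pj u); lia.
  case: (u j) uj E sC du => // y _ E sC du; rewrite E.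
  suff <- : segment_mon p j d (others p j u) y =
    (segment_mon p j d (others p j u) y.+1 - U_(j) + U_(p))%MM by [].
  case: d du {E sC bound split dC} => [|e] du; first by lia.
  by rewrite segment_addj addmK -segment_addp //; lia.
rewrite big_seq [X in (_ <= X)%N]big_seq; apply: leq_sum => w /mem_rem wk.
rewrite !split // size_iota size_map leq_add2l -(size_map (fun v : mon => v j)).
by have [] := sum_iota_le_lt (exponents_uniq pj dC uC w) (bound w).
Qed.

End Pair.

(** Compressing in [p] and a variable in which stability fails lowers the
    height, so finitely many compressions reach a stable set. *)
Lemma stabilize (p : 'I_N) d C B :
  homog_monomials d.+1 C -> homog_monomials d B -> shadow_in C B -> supported_from p C ->
  exists C1 B1, [/\ homog_monomials d.+1 C1, homog_monomials d B1, shadow_in C1 B1,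
    supported_from p C1 & [/\ stable p C1, size C1 = size C & size B1 = size B]].
Proof.
have [n] := ubnP (height p C); elim: n C B => // n IH C B hn hC hB sh sC.
pose ok u (j : 'I_N) := (j != p) && (0 < u j)%N ==> ((u - U_(j) + U_(p))%MM \in C).
have [/allP st|/allPn[u uC]] := boolP (all (fun u => [forall j, ok u j]) C).
  exists C, B; split=> //; split=> // u j uC jp uj.
  by have /forallP/(_ j) := st u uC; rewrite /ok jp uj.
rewrite negb_forall => /existsP[j]; rewrite negb_imply => /andP[/andP[jp uj] unC].
have pj : p != j by rewrite eq_sym.
have pj' : (p <= j)%N.
  by rewrite leqNgt; apply: contraL uj => /(sC u j uC) ->.
have lt := compress_height pj hC (ex_intro2 _ _ u uC (introT andP (conj uj unC))).
case: (hC) (hB) => uC' dC [uB dB].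
have deg e (D : seq mon) : uniq D -> (forall u, u \in D -> mdeg u = e) ->
    homog_monomials e (compress p j e D).
  move=> uD dD; split; first exact: compress_uniq.
  by move=> v; rewrite mem_compress // => /andP[/eqP].
case: (IH (compress p j d.+1 C) (compress p j d B)).
- by apply: leq_trans lt _.
- exact: deg.
- exact: deg.
- exact: compress_shadow.
- exact: compress_support.
move=> C1 [B1 [h1 h2 h3 h4 [h5 s1 s2]]]; exists C1, B1; split=> //; split=> //.
  by rewrite s1 compress_size.
by rewrite s2 compress_size.
Qed.

End Shadow.

(** * The theorems of Green and Macaulay for sets of monomials *)

Section Macaulay.
Variable N : nat.
Local Notation mon := 'X_{1..N}.
Implicit Types (C B D : seq mon) (u v w : mon).

Definition colon (p : 'I_N) C := [seq (u - U_(p))%MM | u : mon <- C & (0 < u p)%N].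
Definition slice (p : 'I_N) C := [seq u : mon <- C | u p == 0%N].

Lemma mem_colon p C v : (v \in colon p C) = ((v + U_(p))%MM \in C).
Proof.
apply/mapP/idP => [[u]|vC].
  by rewrite mem_filter => /andP[up uC] ->; rewrite submK ?mnm1_le.
exists (v + U_(p))%MM; last by rewrite addmK.
by rewrite mem_filter vC mnmDE mnm1E eqxx addn1.
Qed.

Lemma size_colon_slice p C : size C = (size (colon p C) + size (slice p C))%N.
Proof.
rewrite size_map !size_filter -(count_predC (fun u : mon => (0 < u p)%N) C).
by congr addn; apply: eq_count => u /=; rewrite lt0n negbK.
Qed.

Lemma colon_homog p d C : homog_monomials d.+1 C -> homog_monomials d (colon p C).
Proof.
case=> uC dC; split=> [|v]; last first.
  by rewrite mem_colon => /dC; rewrite mdegD mdeg1 addn1 => -[].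
rewrite map_inj_in_uniq ?filter_uniq // => u v; rewrite !mem_filter.
by case/andP=> up _ /andP[vp _] E; rewrite -(submK (mnm1_le up)) E submK ?mnm1_le.
Qed.

Lemma slice_homog p d C : homog_monomials d C -> homog_monomials d (slice p C).
Proof.
case=> uC dC; split=> [|v]; first exact: filter_uniq.
by rewrite mem_filter => /andP[_ /dC].
Qed.

Lemma colon_stable (p : 'I_N) C : stable p C -> stable p (colon p C).
Proof.
move=> st v j; rewrite !mem_colon => vC jp vj.
have := st _ j vC jp; rewrite mnmDE mnm1E => /(_ (ltn_addr _ vj)).
congr (_ \in C); apply/mnmP=> k; rewrite !mnmDE !mnmBE !mnmDE !mnm1E.
by case: (eqVneq j k) vj jp => [->|_] vk kp; rewrite ?subn0 //;
   case: eqP kp => [->|_] //; rewrite ?eqxx //; lia.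
Qed.

Lemma colon_supported (p : 'I_N) C : supported_from p C -> supported_from p (colon p C).
Proof.
by move=> sC v i; rewrite mem_colon => /sC /[apply]; rewrite mnmDE; lia.
Qed.

Lemma slice_supported (p : 'I_N) C : supported_from p C -> supported_from p.+1 (slice p C).
Proof.
move=> sC u i; rewrite mem_filter ltnS leq_eqVlt => /andP[/eqP up uC].
by case/orP=> [/eqP/val_inj->|/(sC _ _ uC)].
Qed.

(** Stability replaces the removed variable by [p], so that the quotient lies
    in the colon set. *)
Lemma slice_shadow (p : 'I_N) C : stable p C -> shadow_in (slice p C) (slice p (colon p C)).
Proof.
move=> st u i; rewrite !mem_filter mem_colon => /andP[/eqP up uC] ui.
have ip : i != p by apply: contraTneq ui => ->; rewrite up.
by rewrite st // mnmBE up.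
Qed.

Definition macaulay_from (q : nat) := forall C B d s,
  homog_monomials d.+1 C -> homog_monomials d B -> shadow_in C B -> supported_from q C ->
  sorted geq s -> (gotzmann_sum s d.+1 <= size C)%N -> (gotzmann_sum s d <= size B)%N.

(** Induction on the degree.  A stable set is its colon set plus its slice; the
    shadow of the slice lies in the slice of the colon set, so Macaulay's bound
    in fewer variables feeds the induction hypothesis for the colon set, and
    Pascal's rule adds up the two contributions. *)
Lemma green_bound (p : 'I_N) : macaulay_from p.+1 -> forall d D b,
  homog_monomials d D -> stable p D -> supported_from p D -> sorted geq b ->
  (gotzmann_sum b d <= size (slice p D))%N -> (gotzmann_sum (map S b) d <= size D)%N.
Proof.
move=> mac; elim=> [|d IH] D b hD stD sD sb lb.
  rewrite gotzmann_sum_mapS0; apply: leq_trans lb _.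
  by rewrite size_filter count_size.
rewrite gotzmann_sum_mapS (size_colon_slice p) addnC; apply: leq_add => //.
apply: IH => //; [exact: colon_homog | exact: colon_stable | exact: colon_supported |].
apply: (mac (slice p D)) lb => //; last exact: slice_supported.
- exact: slice_homog.
- by apply: slice_homog; apply: colon_homog.
- exact: slice_shadow.
Qed.

(** The shadow of a stable set contains its colon set.  If the colon set were
    too small, the slice would be large by Pascal's rule, by at least one more
    than the lowered sequence [b] predicts; Macaulay's bound for the slice with
    [b ++ [:: 0]] and then Green's bound for the colon set contradict this. *)
Lemma macaulay_step (p : 'I_N) : macaulay_from p.+1 -> macaulay_from p.
Proof.
move=> mac C B d s hC hB sh sC ss; case: (stabilize hC hB sh sC).
move=> C1 [B1 [{}hC {}hB {}sh {}sC [stC <- <-]]] {C B} le.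
have sub : (size (colon p C1) <= size B1)%N.
  apply: uniq_leq_size => [|v]; first by have [] := colon_homog p hC.
  by rewrite mem_colon => /(sh _ p); rewrite addmK mnmDE mnm1E eqxx addn1; apply.
apply: leq_trans sub.
have [b [z [E sb sb0]]] := sorted_mapS_zeros ss.
rewrite leqNgt; apply/negP => lt.
move: le lt; rewrite E !gotzmann_sum_zeros gotzmann_sum_mapS size_map.
rewrite (size_colon_slice p) => le lt.
have key : (gotzmann_sum (b ++ [:: 0%N]) d.+1 <= size (slice p C1))%N.
  by rewrite (gotzmann_sum_zeros b 1); move: le lt; lia.
have := mac _ (slice p (colon p C1)) d _ (slice_homog p hC) _ _ _ sb0 key.
move/(_ (slice_homog p (colon_homog p hC)) (slice_shadow stC) (slice_supported sC)).
move/(green_bound mac (colon_homog p hC) (colon_stable stC) (colon_supported sC) sb0).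
by rewrite map_cat gotzmann_sum_cat1 size_map; move: lt; lia.
Qed.

Theorem macaulay_shadow C B d s :
  homog_monomials d.+1 C -> homog_monomials d B -> shadow_in C B ->
  sorted geq s -> (gotzmann_sum s d.+1 <= size C)%N -> (gotzmann_sum s d <= size B)%N.
Proof.
move=> hC hB sh; have mac0 : macaulay_from 0; last by apply: mac0.
move: {C B d s hC hB sh} 0%N => q; have [n] := ubnP (N - q).
elim: n q => // n IH q lt.
have [qN|qN] := ltnP q N.
  apply: (@macaulay_step (Ordinal qN)); apply: IH => //=; lia.
move=> C B d [|a s] [_ dC] _ _ sC _ //.
case: C dC sC => [|u C] dC sC /=.
  have : (0 < 'C(d.+1 + a, a))%N by rewrite bin_gt0; lia.
  lia.
have := dC u (mem_head _ _); suff -> : u = 0%MM by rewrite mdeg0.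
by apply/mnmP=> i; rewrite mnm0E; apply: sC (mem_head _ _) _; have := ltn_ord i; lia.
Qed.

End Macaulay.

(** * Linear algebra modulo a subspace *)

Section ModuloSubspace.
Variables (k : fieldType) (V : lmodType k).
Implicit Types (J : V -> Prop) (f g : V).

Definition subspace J := J 0 /\ forall a f g, J f -> J g -> J (a *: f + g).

Section Closure.
Variable J : V -> Prop.
Hypothesis linJ : subspace J.

Lemma subspaceZ a f : J f -> J (a *: f).
Proof. by move=> Jf; rewrite -[_ *: _]addr0; apply: linJ.2 => //; apply: linJ.1. Qed.

Lemma subspaceD f g : J f -> J g -> J (f + g).
Proof. by move=> Jf Jg; rewrite -[f]scale1r; apply: linJ.2. Qed.

Lemma subspaceB f g : J f -> J g -> J (f - g).
Proof. by move=> Jf Jg; rewrite addrC -scaleN1r; apply: linJ.2. Qed.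

Lemma subspace_sum (I : Type) (s : seq I) (P : pred I) (F : I -> V) :
  (forall i, P i -> J (F i)) -> J (\sum_(i <- s | P i) F i).
Proof.
by move=> JF; apply: (big_ind J) => //; [apply: linJ.1 | apply: subspaceD].
Qed.

End Closure.

Definition free_mod J (I : finType) (E : I -> V) :=
  forall c : I -> k, J (\sum_i c i *: E i) -> forall i, c i = 0.

Definition span_mod J (I : finType) (E : I -> V) f :=
  exists c : I -> k, J (f - \sum_i c i *: E i).

(** Steinitz: a matrix with more rows than columns has a nonzero row kernel. *)
Lemma free_le_span J (linJ : subspace J) (I I' : finType) (E : I -> V) (E' : I' -> V) :
  free_mod J E' -> (forall i, span_mod J E (E' i)) -> (#|I'| <= #|I|)%N.
Proof.
move=> fr sp; case: (fin_all_exists sp) => c Hc.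
pose M : 'M[k]_(#|I'|, #|I|) := \matrix_(i, j) c (enum_val i) (enum_val j).
rewrite leqNgt; apply/negP => lt.
have : kermx M != 0.
  rewrite -mxrank_eq0 mxrank_ker -lt0n subn_gt0.
  exact: leq_ltn_trans (rank_leq_col M) lt.
case/rowV0Pn=> u /sub_kermxP uM /eqP; apply; apply/rowP=> i; rewrite mxE.
suff /fr /(_ (enum_val i)) : J (\sum_i' u 0 (enum_rank i') *: E' i').
  by rewrite enum_valK.
have -> : \sum_i' u 0 (enum_rank i') *: E' i' =
  \sum_i' u 0 (enum_rank i') *: (E' i' - \sum_j c i' j *: E j).
  under [RHS]eq_bigr do rewrite scalerBr.
  rewrite sumrB [X in _ - X](_ : _ = 0) ?subr0 //.
  under eq_bigr do rewrite scaler_sumr.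
  rewrite exchange_big big1 //= => j _.
  under eq_bigr do rewrite scalerA.
  rewrite -scaler_suml (_ : \sum_i' _ = 0) ?scale0r //.
  have := congr1 (fun A : 'rV_ _ => A 0 (enum_rank j)) uM.
  rewrite !mxE => uM0; rewrite -[RHS]uM0.
  rewrite [RHS](reindex (@enum_rank I')) /=; last first.
    by apply: onW_bij; exact: enum_rank_bij.
  by apply: eq_bigr => a _; rewrite mxE !enum_rankK.
by apply: subspace_sum => // i' _; apply: subspaceZ.
Qed.

End ModuloSubspace.

(** * Monomial bases of graded pieces *)

Section GradedPiece.
Variables (k : closedFieldType) (n : nat).
Local Notation S := {mpoly k[n.+1]}.
Local Notation mon := 'X_{1..n.+1}.
Implicit Types (J : S -> Prop) (f g : S) (u v w : mon) (a b d : nat).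

Definition inside a b u := [forall i : 'I_n.+1, (u i != 0%N) ==> (a <= i <= b)%N].

Definition monomials a b d : seq mon :=
  [seq u <- [seq bmnm x | x <- enum {: 'X_{1..n.+1 < d.+1}}]
     | (mdeg u == d) && inside a b u].

(** The degree [d] piece of k[x_a, ..., x_b], see [inAP]. *)
Definition inA a b d f := {subset msupp f <= monomials a b d}.

Lemma insideP a b u :
  reflect (forall i : 'I_n.+1, u i != 0%N -> (a <= i <= b)%N) (inside a b u).
Proof. by apply: (iffP forallP) => h i; have /implyP := h i. Qed.

Lemma mem_monomials a b d u : (u \in monomials a b d) = (mdeg u == d) && inside a b u.
Proof.
rewrite mem_filter; case: eqP => //= du; case: inside => //=.
have lt : (mdeg u < d.+1)%N by rewrite du.
by apply/mapP; exists (BMultinom lt); rewrite ?mem_enum.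
Qed.

Lemma monomials_uniq a b d : uniq (monomials a b d).
Proof. by rewrite filter_uniq // map_inj_uniq ?enum_uniq //; apply: val_inj. Qed.

Lemma inAP a b d f : inA a b d f <-> f \is d.-homog /\ subring a b f.
Proof.
split=> [h|[/dhomogP hf sf] u uf]; last first.
  by rewrite mem_monomials hf //= eqxx; apply/insideP; apply: sf.
split; first by apply/dhomogP=> u /h; rewrite mem_monomials => /andP[/eqP].
by move=> u /h; rewrite mem_monomials => /andP[_ /insideP].
Qed.

Lemma inA_subspace a b d : subspace (inA a b d).
Proof.
split=> [u|c f g hf hg u]; first by rewrite mcoeff_msupp mcoeff0 eqxx.
move/msuppD_le; rewrite mem_cat => /orP[/msuppZ_le|]; [exact: hf | exact: hg].
Qed.

Lemma inA_mon a b d u : u \in monomials a b d -> inA a b d 'X_[u].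
Proof. by move=> uM v; rewrite msuppX inE => /eqP->. Qed.

Lemma inA_comb a b d (B : seq mon) (c : mon -> k) :
  {subset B <= monomials a b d} -> inA a b d (\sum_(u <- B) c u *: 'X_[u]).
Proof.
move=> sB; have linA := inA_subspace a b d.
rewrite big_seq; apply: (subspace_sum linA) => u uB; apply: (subspaceZ linA).
by apply: inA_mon; apply: sB.
Qed.

Lemma inA_mulX a b d f (i : 'I_n.+1) : (a <= i <= b)%N ->
  inA a b d f -> inA a b d.+1 ('X_i * f).
Proof.
move=> ib hf u; rewrite mulrC (perm_mem (msuppMX _ _)) => /mapP[v /hf].
rewrite !mem_monomials => /andP[/eqP dv /insideP sv] ->.
rewrite mdegD mdeg1 dv eqxx; apply/insideP=> j.
by rewrite mnmDE mnm1E; case: (eqVneq i j) => [<-|_] //=; rewrite add0n => /sv.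
Qed.

Lemma mcoeff_comb (B : seq mon) (c : mon -> k) v : uniq B ->
  (\sum_(u <- B) c u *: 'X_[u] : S)@_v = if v \in B then c v else 0.
Proof.
move=> uB; rewrite raddf_sum /=.
have -> : \sum_(u <- B) (c u *: 'X_[u] : S)@_v = \sum_(u <- B | u == v) c u.
  rewrite [RHS]big_mkcond; apply: eq_bigr => u _.
  by rewrite mcoeffZ mcoeffX; case: eqP => _; rewrite ?mulr1 ?mulr0.
case: ifP => vB; last first.
  by rewrite big_seq_cond big_pred0 // => u; case: eqP => [->|]; rewrite ?vB ?andbF.
by rewrite -big_filter (filter_pred1_uniq uB vB) big_seq1.
Qed.

Lemma inA_comb_monomials a b d f : inA a b d f ->
  f = \sum_(u <- monomials a b d) f@_u *: 'X_[u].
Proof.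
move=> hf; apply/mpolyP=> v; rewrite mcoeff_comb ?monomials_uniq //.
by case: ifP => // /negbT vM; apply/eqP; rewrite mcoeff_eq0; apply: contra vM => /hf.
Qed.

Definition monomial_basis a b d J (B : seq mon) :=
  [/\ uniq B, {subset B <= monomials a b d},
      forall c : mon -> k, J (\sum_(u <- B) c u *: 'X_[u]) -> forall u, u \in B -> c u = 0
    & forall f, inA a b d f -> exists c : mon -> k, J (f - \sum_(u <- B) c u *: 'X_[u])].

Lemma big_nth_comb (B : seq mon) (c : mon -> k) (e := [seq 'X_[u] | u <- B] : seq S) :
  \sum_(i < size e) c (nth 0%MM B i) *: e`_i = \sum_(u <- B) c u *: 'X_[u].
Proof.
rewrite (big_nth 0%MM) big_mkord /e size_map; apply: eq_bigr => i _.
by rewrite (nth_map 0%MM).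
Qed.

Lemma index_comb (B : seq mon) (e := [seq 'X_[u] | u <- B] : seq S)
  (c : 'I_(size e) -> k) : uniq B ->
  exists c' : mon -> k, forall i : 'I_(size e), c i = c' (nth 0%MM B i).
Proof.
move=> uB; exists (fun u => if insub (index u B) is Some i then c i else 0) => i.
have iB : (i < size B)%N by rewrite -(size_map (fun u => 'X_[u] : S)) ltn_ord.
rewrite index_uniq //; case: insubP => [j _ /val_inj -> //|].
by rewrite ltn_ord.
Qed.

(** Coefficients indexed by monomials rather than by positions make restriction
    and glueing of bases painless. *)
Lemma monomial_basisP a b d J B (J0 : J 0) :
  quotient_basis a b d J [seq 'X_[u] | u <- B] <-> monomial_basis a b d J B.
Proof.
split=> [[h1 h2 h3]|[uB sB h2 h3]].
  have uB : uniq B.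
    apply/(uniqP 0%MM) => i j; rewrite !inE => iB jB E.
    apply/eqP/negP=> /negP ij.
    set e := [seq 'X_[u] | u <- B] in h1 h2 h3.
    have ie : (i < size e)%N by rewrite size_map.
    have je : (j < size e)%N by rewrite size_map.
    (* the relation between two equal entries *)
  pose c (x : 'I_(size e)) : k := (val x == i)%:R - (val x == j)%:R.
    suff /(h2 c)/(_ (Ordinal ie)) : J (\sum_x c x *: e`_x).
      by rewrite /c /= eqxx (negbTE ij) subr0 => /eqP; rewrite oner_eq0.
    rewrite (bigD1 (Ordinal ie)) //= (bigD1 (Ordinal je)) /=; last first.
      by rewrite -val_eqE /= eq_sym.
    rewrite big1 => [|x /andP[xi xj]]; last first.
      by move: xi xj; rewrite -!val_eqE /c => /= /negbTE-> /negbTE->; rewrite subrr scale0r.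
    rewrite /c /= !eqxx (negbTE ij) eq_sym (negbTE ij) addr0 subr0 sub0r.
    by rewrite !(nth_map 0%MM) // E scale1r scaleN1r subrr.
  split=> // [u uB'|c Jc u uB'|f /inAP[hf sf]].
  - have /inAP h : ('X_[u] : S) \is d.-homog /\ subring a b ('X_[u] : S).
      by apply: h1; rewrite map_f.
    by apply: h; rewrite msuppX inE.
  - have := h2 (fun i => c (nth 0%MM B i)); rewrite big_nth_comb => /(_ Jc) h.
    have ie : (index u B < size [seq 'X_[u] : S | u <- B])%N by rewrite size_map index_mem.
    by have := h (Ordinal ie); rewrite /= nth_index.
  - have [c Jc] := h3 f hf sf; have [c' E] := index_comb c uB.
    exists c'; rewrite -big_nth_comb; move: Jc.
    by under eq_bigr do rewrite E.
split=> [f /mapP[u uB' ->]|c Jc i|f hf sf].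
- by apply/inAP; apply: inA_mon; apply: sB.
- have [c' E] := index_comb c uB; rewrite E; apply: h2.
    by move: Jc; under eq_bigr do rewrite E; rewrite big_nth_comb.
  by rewrite mem_nth // -(size_map (fun u => 'X_[u] : S)) ltn_ord.
- have [c Jc] := h3 f (proj2 (inAP _ _ _ _) (conj hf sf)).
  by exists (fun i => c (nth 0%MM B i)); rewrite big_nth_comb.
Qed.

(** Only the elements of the graded piece are ever tested for membership, so
    ideals may be replaced by any subspaces with the same trace on it. *)
Lemma quotient_basis_ext a b d J J' e :
  (forall f, inA a b d f -> (J f <-> J' f)) ->
  quotient_basis a b d J e -> quotient_basis a b d J' e.
Proof.
have linA := inA_subspace a b d.
move=> ext [h1 h2 h3].
have Ae (c : 'I_(size e) -> k) : inA a b d (\sum_(i < size e) c i *: e`_i).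
  apply: (subspace_sum linA) => i _; apply: (subspaceZ linA).
  by apply/inAP; apply: h1; rewrite mem_nth.
split=> // [c Jc|f hf sf]; first by apply: h2; apply/ext.
have [c Jc] := h3 f hf sf; exists c; apply/ext => //.
by apply: (subspaceB linA) => //; apply/inAP.
Qed.

(** [u] is the leading monomial of an element of [J]. *)
Definition reducible a b d J u :=
  exists g, [/\ inA a b d g, (forall v, v \in msupp g -> (v < u)%O) & J ('X_[u] - g)].

Definition standard a b d J : seq mon :=
  [seq u <- monomials a b d | if excluded_middle_informative (reducible a b d J u)
                         then false else true].

Lemma mem_standard a b d J u : reflect (u \in monomials a b d /\ ~ reducible a b d J u)
  (u \in standard a b d J).
Proof.
rewrite [X in reflect _ X]mem_filter.
case: (excluded_middle_informative (reducible a b d J u)) => h /=.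
  by apply: ReflectF => -[].
by apply: (iffP idP) => [|[]].
Qed.

(** The leading monomial of a combination of standard monomials is standard, so
    the combination is not in [J]; nonstandard monomials are rewritten into
    smaller ones, a process that terminates. *)
Lemma standard_basis a b d J : subspace J -> monomial_basis a b d J (standard a b d J).
Proof.
move=> linJ; have linA := inA_subspace a b d.
have us : uniq (standard a b d J) by apply: filter_uniq; apply: monomials_uniq.
have ss : {subset standard a b d J <= monomials a b d} by move=> u /mem_standard[].
split=> // [c Jc u uB|f hf].
  apply/eqP/negP=> /negP cu; set f := \sum_(v <- _) _ in Jc.
  have fE v : f@_v = if v \in standard a b d J then c v else 0 by rewrite mcoeff_comb.
  have f0 : f != 0 by apply: contra_neq cu => f0; move: (fE u); rewrite uB f0 mcoeff0.
  pose u0 := mlead f; have := mlead_supp f0; rewrite -/u0 => u0f.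
  have c0 : f@_u0 != 0 by rewrite -mcoeff_msupp.
  have : u0 \in standard a b d J by move: c0; rewrite fE; case: ifP; rewrite ?eqxx.
  case/mem_standard=> u0M; apply; exists ('X_[u0] - (f@_u0)^-1 *: f).
  have hg : inA a b d ('X_[u0] - (f@_u0)^-1 *: f).
    apply: (subspaceB linA); first exact: inA_mon.
    apply: (subspaceZ linA).
    exact: inA_comb.
  split=> //; last by rewrite opprB addrCA subrr addr0; apply: (subspaceZ linJ).
  move=> v; rewrite mcoeff_msupp mcoeffB mcoeffX mcoeffZ => h.
  case: (ltgtP v u0) => // [lt|E].
    move: h; rewrite (mcoeff_gt_mlead lt) mulr0 subr0.
    by case: (eqVneq u0 v) lt => [->|_]; rewrite ?ltxx ?eqxx.
  by rewrite E eqxx mulVf ?subrr ?eqxx in h.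
pose spanned g := exists c : mon -> k, J (g - \sum_(u <- standard a b d J) c u *: 'X_[u]).
have lin : subspace spanned.
  split.
    by exists (fun=> 0); rewrite big1 ?subrr => [|u _]; [exact: linJ.1 | rewrite scale0r].
  move=> x g h [c cg] [c' ch]; exists (fun u => x * c u + c' u).
  have := linJ.2 x _ _ cg ch; congr J.
  under [in RHS]eq_bigr do rewrite scalerDl -scalerA.
  by rewrite big_split -scaler_sumr /= scalerBr opprD addrACA.
have Jsp g : J g -> spanned g.
  by move=> Jg; exists (fun=> 0); rewrite big1 ?subr0 // => u _; rewrite scale0r.
rewrite -/(spanned f) (inA_comb_monomials hf) big_seq; apply: (subspace_sum lin) => u uM.
apply: (subspaceZ lin); move: uM; elim/(@ltmwf n.+1): u => u IH uM.
have [uS|/mem_standard uS] := boolP (u \in standard a b d J).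
  exists (fun v => (v == u)%:R).
  rewrite (bigD1_seq u) //= eqxx scale1r big1 ?addr0 ?subrr; first exact: linJ.1.
  by move=> v /negbTE->; rewrite scale0r.
have [g [gA lt Jg]] : reducible a b d J u by apply: NNPP => h; apply: uS.
rewrite -(subrK g 'X_[u]); apply: (subspaceD lin); first exact: Jsp.
rewrite [g]mpolyE big_seq; apply: (subspace_sum lin) => v vg; apply: (subspaceZ lin).
by apply: IH; [apply: lt | apply: gA].
Qed.

Lemma monomial_basis_card a b d J e B : subspace J ->
  quotient_basis a b d J e -> monomial_basis a b d J B -> size e = size B.
Proof.
move=> linJ he /(monomial_basisP _ _ _ _ linJ.1).
rewrite -(size_map (fun u => 'X_[u] : S)).
move: {B} [seq _ | _ <- _] he => e' he he'.
suff le e1 e2 : quotient_basis a b d J e1 -> quotient_basis a b d J e2 ->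
    (size e1 <= size e2)%N by apply/eqP; rewrite eqn_leq !le.
move=> [h1 h2 h3] [h1' h2' h3'].
have := @free_le_span _ _ J linJ 'I_(size e2) 'I_(size e1)
  (fun i => e2`_i) (fun i => e1`_i).
rewrite !card_ord; apply=> // i.
by have [] := h1 e1`_i; rewrite ?mem_nth //; apply: h3'.
Qed.

End GradedPiece.

Arguments monomials {n} a b d.
Arguments inA_subspace {k n} a b d.
(** * Growth of Hilbert functions *)

Section Regularity.
Variables (k : closedFieldType) (n : nat).
Local Notation S := {mpoly k[n.+1]}.
Local Notation mon := 'X_{1..n.+1}.
Local Notation pt := 'rV[k]_n.+1.
Implicit Types (J : S -> Prop) (f g : S) (u v w : mon) (a b d : nat).

Lemma standard_homog a b d J : homog_monomials d (standard a b d J).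
Proof.
split=> [|u /mem_standard[]]; first by apply: filter_uniq; apply: monomials_uniq.
by rewrite mem_monomials => /andP[/eqP].
Qed.

(** A multiple of a leading monomial is one again, as the monomial order is
    compatible with multiplication. *)
Lemma standard_shadow a b d J J' :
  (forall (i : 'I_n.+1) f, (a <= i <= b)%N -> J f -> J' ('X_i * f)) ->
  shadow_in (standard a b d.+1 J') (standard a b d J).
Proof.
move=> JJ' u i /mem_standard[uM ured] ui.
move: (uM); rewrite mem_monomials => /andP[/eqP du /insideP inu].
have ib : (a <= i <= b)%N by apply: inu; rewrite -lt0n.
have vM : (u - U_(i))%MM \in monomials a b d.
  rewrite mem_monomials (mdeg_sub_mnm1 du ui) eqxx; apply/insideP=> j.
  by rewrite mnmBE => h; apply: inu; apply: contraNneq h => ->.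
have Eu := submK (mnm1_le ui).
apply/mem_standard; split=> // -[g [gA lt Jg]]; apply: ured; exists ('X_i * g); split.
- exact: inA_mulX.
- move=> w; rewrite mulrC (perm_mem (msuppMX _ _)) => /mapP[v vg ->].
  by rewrite -[X in (_ < X)%O]Eu [X in (_ < X)%O]addmC ltmc_add2r lt.
- rewrite -[X in 'X_[X] - _]Eu mpolyXD mulrC -mulrBr; exact: JJ'.
Qed.

Lemma macaulay_quotient a b d J J' s :
  (forall (i : 'I_n.+1) f, (a <= i <= b)%N -> J f -> J' ('X_i * f)) ->
  sorted geq s -> (gotzmann_sum s d.+1 <= size (standard a b d.+1 J'))%N ->
  (gotzmann_sum s d <= size (standard a b d J))%N.
Proof.
move=> JJ'; apply: macaulay_shadow; [exact: standard_homog | exact: standard_homog |].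
exact: standard_shadow.
Qed.

Lemma standard_quotient_basis a b d J : subspace J ->
  quotient_basis a b d J [seq 'X_[u] | u <- standard a b d J].
Proof. by move=> linJ; apply/monomial_basisP; [exact: linJ.1 | exact: standard_basis]. Qed.

(** The degree [d+1] piece of J + (h), for [h] of degree one and [J] given in
    degree [d+1]. *)
Definition sum_principal a b d (h : S) J f := exists2 q, inA a b d q & J (f - h * q).

Lemma sum_principal_subspace a b d h J : subspace J -> subspace (sum_principal a b d h J).
Proof.
move=> linJ; have linA := inA_subspace (k := k) (n := n) a b d.
split; first by exists 0; [exact: linA.1 | rewrite mulr0 subr0; exact: linJ.1].
move=> c f g [q qA Jf] [q' qA' Jg]; exists (c *: q + q'); first exact: linA.2.
have := linJ.2 c _ _ Jf Jg; congr J.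
by rewrite mulrDr scalerBr -scalerAr opprD addrACA.
Qed.

(** The exact sequence 0 -> A_d/J -> A_(d+1)/J' -> A_(d+1)/(J' + h A_d) -> 0,
    whose first map is the multiplication by [h]: the multiples by [h] of a
    basis of the first term, together with lifts of a basis of the last, form a
    basis of the middle term. *)
Lemma standard_exact a b d h J J' : subspace J -> subspace J' ->
  (forall f, inA a b d f -> inA a b d.+1 (h * f)) ->
  (forall f, J f -> J' (h * f)) ->
  (forall f, inA a b d f -> J' (h * f) -> J f) ->
  size (standard a b d.+1 J') =
    (size (standard a b d J) + size (standard a b d.+1 (sum_principal a b d h J')))%N.
Proof.
move=> linJ linJ' hA hJ inj.
have linA := inA_subspace (k := k) (n := n) a b.
have := standard_quotient_basis a b d linJ.
have := standard_quotient_basis a b d.+1 linJ'.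
have := standard_quotient_basis a b d.+1 (sum_principal_subspace a b d h linJ').
rewrite -!(size_map (fun u => 'X_[u] : S)).
move: [seq _ | _ <- standard a b d J] => e1.
move: [seq _ | _ <- standard a b d.+1 (sum_principal a b d h J')] => e2.
move: [seq _ | _ <- standard a b d.+1 J'] => e [p1 p2 p3] [q1 q2 q3] [r1 r2 r3].
pose E (x : 'I_(size e1) + 'I_(size e2)) : S :=
  match x with inl i => h * e1`_i | inr j => e2`_j end.
have combE (c : 'I_(size e1) + 'I_(size e2) -> k) : \sum_x c x *: E x =
    h * (\sum_i c (inl i) *: e1`_i) + \sum_j c (inr j) *: e2`_j.
  rewrite big_sumType mulr_sumr /=; congr (_ + _).
  by apply: eq_bigr => i _; rewrite scalerAr.
have e1A (c : 'I_(size e1) -> k) : inA a b d (\sum_i c i *: e1`_i).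
  apply: (subspace_sum (linA d)) => i _; apply: (subspaceZ (linA d)).
  by apply/inAP; apply: r1; rewrite mem_nth.
apply/eqP; rewrite eqn_leq; apply/andP; split.
  have := @free_le_span _ _ J' linJ' _ 'I_(size e) E (fun i => e`_i).
  rewrite card_sum !card_ord; apply=> // i.
  have [hi si] := q1 e`_i (mem_nth _ (ltn_ord i)).
  have [c [q qA Jq]] := p3 _ hi si.
  have [c' Jc'] := r3 q (proj1 (proj1 (inAP _ _ _ _) qA)) (proj2 (proj1 (inAP _ _ _ _) qA)).
  exists (fun x => match x with inl i => c' i | inr j => c j end); rewrite combE.
  have := subspaceD linJ' (hJ _ Jc') Jq; congr J'.
  by rewrite mulrBr /=; ring.
have := @free_le_span _ _ J' linJ' 'I_(size e) _ (fun i => e`_i) E.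
rewrite card_sum !card_ord; apply.
  move=> c; rewrite combE => Jc.
  have c2 j : c (inr j) = 0.
    apply: (p2 (fun j => c (inr j))).
    exists (- \sum_i c (inl i) *: e1`_i); last by rewrite mulrN opprK addrC.
    by rewrite -scaleN1r; apply: (subspaceZ (linA d)).
  case=> [i|j] //; apply: (r2 (fun i => c (inl i))); apply: inj => //.
  by move: Jc; rewrite [X in _ + X]big1 ?addr0 // => j _; rewrite c2 scale0r.
suff EA x : inA a b d.+1 (E x) by move=> x; have /inAP[] := EA x; apply: q3.
case: x => [i|j] /=; last by apply/inAP; apply: p1; rewrite mem_nth.
by apply: hA; apply/inAP; apply: r1; rewrite mem_nth.
Qed.

(** No homogeneity here: on homogeneous polynomials this is the same as
    membership in the vanishing ideal, and it is visibly an ideal. *)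
Definition zero_on (Y : pt -> Prop) f := forall v : pt, Y v -> f.@[v ord0] = 0.

Lemma zero_on_subspace Y : subspace (zero_on Y).
Proof.
split=> [v _|c f g hf hg v Yv]; first by rewrite meval0.
by rewrite mevalD mevalZ hf // hg // mulr0 addr0.
Qed.

Lemma zero_on_mul Y f g : zero_on Y g -> zero_on Y (f * g).
Proof. by move=> hg v Yv; rewrite mevalM hg // mulr0. Qed.

(** Adding a point outside the span raises the dimension, at most [N] times. *)
Lemma finite_row_span N (T : Type) (Q : T -> Prop) (ev : T -> 'rV[k]_N) :
  exists F : seq T, (forall x, List.In x F -> Q x) /\
    forall x, Q x -> ev x \in <<[seq ev y | y <- F]>>%VS.
Proof.
suff : forall c (F : seq T), (forall x, List.In x F -> Q x) ->
    (N - \dim <<[seq ev y | y <- F]>> <= c)%N ->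
    exists F' : seq T, (forall x, List.In x F' -> Q x) /\
      forall x, Q x -> ev x \in <<[seq ev y | y <- F']>>%VS.
  by move=> /(_ _ [::] (fun _ => False_ind _) (leqnn _)).
elim=> [|c IH] F QF dimF.
  exists F; split=> // x _; have -> : <<[seq ev y | y <- F]>>%VS = fullv.
    apply/eqP; rewrite eqEdim subvf dimvf /dim /= mul1n; lia.
  exact: memvf.
have [all|] := classic (forall x, Q x -> ev x \in <<[seq ev y | y <- F]>>%VS).
  by exists F.
move=> nall; have [x] := not_all_ex_not _ _ nall; move=> nx.
have [Qx /negP xF] := imply_to_and _ _ nx.
have QxF y : List.In y (x :: F) -> Q y by case=> [<-|/QF].
apply: (IH _ QxF); rewrite /=.
have : (\dim <<[seq ev y | y <- F]>> < \dim <<ev x :: [seq ev y | y <- F]>>)%N.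
  rewrite ltnNge; apply: contra xF => le.
  have sub : (<<[seq ev y | y <- F]>> <= <<ev x :: [seq ev y | y <- F]>>)%VS.
    by rewrite span_cons addvSr.
  have /eqP -> : <<[seq ev y | y <- F]>>%VS == <<ev x :: [seq ev y | y <- F]>>%VS.
    by rewrite eqEdim sub le.
  by rewrite memv_span // mem_head.
move: dimF; lia.
Qed.

(** A polynomial of degree [j] takes at [v] a value that depends linearly on
    the vector of the monomials of degree [j] at [v], and finitely many such
    vectors span them all. *)
Lemma detecting_points a b e (Y : pt -> Prop) :
  exists F : seq pt, (forall v : pt, v \in F -> Y v) /\
    forall j f, (j <= e)%N -> inA a b j f ->
      (forall v : pt, v \in F -> f.@[v ord0] = 0) -> zero_on Y f.
Proof.
have one j : exists F : seq pt, (forall v : pt, v \in F -> Y v) /\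
    forall f, inA a b j f -> (forall v : pt, v \in F -> f.@[v ord0] = 0) -> zero_on Y f.
  pose N := size (monomials (n := n) a b j).
  pose ev (v : pt) : 'rV[k]_N := \row_i ('X_[nth 0%MM (monomials a b j) i] : S).@[v ord0].
  have evE f (v : pt) : inA a b j f -> f.@[v ord0] =
      \sum_(i < N) f@_(nth 0%MM (monomials a b j) i) * ev v 0 i.
    move=> fA; rewrite {1}(inA_comb_monomials fA) raddf_sum /= (big_nth 0%MM) big_mkord.
    by apply: eq_bigr => i _; rewrite mevalZ mxE.
  have [F [QF sp]] := finite_row_span Y ev.
  have InE (v : pt) (F' : seq pt) : v \in F' -> List.In v F'.
    by elim: F' => //= y F' IH; rewrite inE => /orP[/eqP->|/IH]; [left | right].
  exists F; split=> [v /InE /QF //|f fA fF v Yv].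
  have := coord_span (X := in_tuple [seq ev y | y <- F]) (sp v Yv) => /= Ev.
  have Ev' i : ev v 0 i = \sum_(x < size [seq ev y | y <- F])
      coord (in_tuple [seq ev y | y <- F]) x (ev v) * ([seq ev y | y <- F]`_x : 'rV_N) 0 i.
    apply: etrans (congr1 (fun y : 'rV_N => y 0 i) Ev) _.
    by apply: etrans (summxE _ _ _ _ _) _; apply: eq_bigr => x _; rewrite mxE.
  rewrite (evE _ _ fA); under eq_bigr do rewrite Ev' mulr_sumr.
  rewrite exchange_big big1 //= => i _.
  under eq_bigr do rewrite mulrCA.
  have iF : (i < size F)%N by rewrite -(size_map ev) ltn_ord.
  by rewrite -mulr_sumr (nth_map 0) // -evE // fF ?mulr0 // mem_nth.
elim: e => [|e [F [YF hF]]].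
  have [F [YF hF]] := one 0%N; exists F; split=> // j f.
  by rewrite leqn0 => /eqP->; apply: hF.
have [F' [YF' hF']] := one e.+1; exists (F ++ F'); split=> [v|j f].
  by rewrite mem_cat => /orP[/YF|/YF'].
rewrite leq_eqVlt => /orP[/eqP->|je] fA fF.
  by apply: hF' => // v vF; apply: fF; rewrite mem_cat vF orbT.
by apply: hF fA _ => // v vF; apply: fF; rewrite mem_cat vF.
Qed.

Definition supported (a b : nat) (Y : pt -> Prop) :=
  forall v : pt, Y v -> v != 0 /\ forall j : 'I_n.+1, ~~ (a <= j <= b)%N -> v ord0 j = 0.

(** Take the coefficients 1, t, t^2, ...: the value at [v] is that of a nonzero
    polynomial in [t], and some [t] is a root of none of them. *)
Lemma nonvanishing_form a b (F : seq pt) :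
  supported a b (fun v : pt => v \in F) ->
  exists h : S, (forall d f, inA a b d f -> inA a b d.+1 (h * f)) /\
    forall v : pt, v \in F -> h.@[v ord0] != 0.
Proof.
move=> hF; have : \prod_(v <- F) rVpoly v != 0.
  rewrite prodf_seq_neq0; apply/allP => v /hF[v0 _] /=.
  by apply: contra v0 => /eqP E; rewrite -(rVpolyK v) E linear0.
case/closed_nonrootP=> t; rewrite /root horner_prod prodf_seq_neq0 => /allP ht.
exists (\sum_(i < n.+1 | (a <= i <= b)%N) t ^+ i *: 'X_i); split.
  move=> d f fA; have linA := inA_subspace (k := k) (n := n) a b d.+1.
  rewrite mulr_suml; apply: (subspace_sum linA) => i ib.
  by rewrite -scalerAl; apply: (subspaceZ linA); apply: inA_mulX.
move=> v vF; have := ht v vF; rewrite /= horner_poly.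
have [_ v0] := hF v vF; rewrite raddf_sum /=.
congr (_ != 0); rewrite [RHS]big_mkcond /=; apply: eq_bigr => i _; rewrite valK.
by case: ifP => [_|/negbT /v0 ->]; rewrite ?mul0r // mevalZ mevalXU mulrC.
Qed.

End Regularity.

(** * Hilbert functions above the Gotzmann number *)

Lemma gotzmann_sum_big s d : (size s <= d)%N ->
  gotzmann_sum s d = (\sum_(i < size s) 'C(d - i + nth 0%N s i, nth 0%N s i))%N.
Proof.
elim: s d => [|a s IH] d; first by rewrite big_ord0.
by case: d => [|d] //= sd; rewrite IH // big_ord_recl /= subn0; congr addn.
Qed.

Lemma binomial_poly_eval a c (x : int) (y : nat) :
  x + c%:~R = y%:Z -> (binomial_poly c a).[x%:~R] = 'C(y, a)%:R.
Proof.
move=> E; rewrite /binomial_poly hornerZ horner_prod.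
have fne : (a`!%:R : rat) != 0 by rewrite pnatr_eq0 -lt0n fact_gt0.
apply: (mulfI fne); rewrite mulrA mulfV // mul1r -natrM mulnC bin_ffact.
have -> : \prod_(j < a) ('X + (c - j%:Z)%:~R%:P).[x%:~R] =
          \prod_(j < a) ((y%:Z - j%:Z)%:~R : rat).
  apply: eq_bigr => j _; rewrite hornerD hornerX hornerC -rmorphD /= -E intz.
  by rewrite addrA.
move: fne => _ {E}; elim: a => [|a IH]; first by rewrite big_ord0 ffactn0.
rewrite big_ord_recr /= IH ffactnSr natrM.
have [ya|ya] := ltnP y a; first by rewrite ffact_small // !mul0r.
by rewrite subzn.
Qed.

Lemma gotzmann_eval P g : gotzmann_number P g ->
  exists s, [/\ sorted geq s, size s = g &
    forall d, (g <= d)%N -> P.[d%:R] = (gotzmann_sum s d)%:R].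
Proof.
case=> s [sz ss ->]; exists s; split=> // d gd.
rewrite gotzmann_sum_big ?sz // horner_sum natr_sum; apply: eq_bigr => i _.
rewrite -[d%:R]/(d%:Z%:~R); apply: binomial_poly_eval.
rewrite intz PoszD -subzn ?(leq_trans (ltnW (ltn_ord i)) gd) //.
by ring.
Qed.

Lemma downward_induction (Q : nat -> Prop) e :
  Q e -> (forall j, (j < e)%N -> Q j.+1 -> Q j) ->
  forall j, (j <= e)%N -> Q j.
Proof.
move=> Qe step j je; have [c Ec] : exists c, (e = j + c)%N by exists (e - j)%N; lia.
elim: c j {je} Ec => [|c IH] j Ec; first by rewrite addn0 in Ec; rewrite -Ec.
by apply: step; [lia | apply: IH; lia].
Qed.

Section RegularityTheorem.
Variables (k : closedFieldType) (n : nat).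
Local Notation S := {mpoly k[n.+1]}.
Local Notation pt := 'rV[k]_n.+1.
Variables (a b : nat) (Y : pt -> Prop).
Hypothesis supY : supported a b Y.

Let H d := size (standard a b d (zero_on Y)).

(** Macaulay's bound passes from each degree to the previous one. *)
Lemma hilbert_lower s e : sorted geq s -> (gotzmann_sum s e <= H e)%N ->
  forall d, (d <= e)%N -> (gotzmann_sum s d <= H d)%N.
Proof.
move=> ss le; apply: downward_induction => // j _.
by apply: macaulay_quotient => // i f _; apply: zero_on_mul.
Qed.

(** Macaulay's bound for the quotient by a linear form [h] that is a
    nonzerodivisor up to degree [e] gives at least the expected increments of
    [H] below [e]; as [H] has the expected value at [e], it cannot exceed it
    before. *)
Lemma hilbert_upper s e m : sorted geq s -> (size s <= m)%N -> (m <= e)%N ->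
  H e = gotzmann_sum s e -> H e.+1 = gotzmann_sum s e.+1 -> (H m <= gotzmann_sum s m)%N.
Proof.
move=> ss sm me He He1; have [b' [z [Es sb _]]] := sorted_mapS_zeros ss.
have szs : size s = (size b' + z)%N by rewrite Es size_cat size_map size_nseq.
have diff d : (m <= d)%N ->
    gotzmann_sum s d.+1 = (gotzmann_sum s d + gotzmann_sum b' d.+1)%N.
  by move=> md; rewrite Es; apply: gotzmann_sum_diff; lia.
have [F [YF det]] := detecting_points a b e Y.
have [|h [hA hF]] := @nonvanishing_form k n a b F; first by move=> v /YF /supY.
pose D d := size (standard a b d.+1 (sum_principal a b d h (zero_on Y))).
have Hexact d : (d <= e)%N -> H d.+1 = (H d + D d)%N.
  move=> de; apply: standard_exact; try exact: zero_on_subspace; try exact: hA.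
    by move=> f; apply: zero_on_mul.
  move=> f fA hf; apply: (det d) => // v vF.
  have /eqP := hf v (YF v vF); rewrite mevalM mulf_eq0 (negbTE (hF v vF)) /=.
  by move/eqP.
have low d : (d <= e)%N -> (gotzmann_sum b' d.+1 <= D d)%N.
  apply: (downward_induction (Q := fun d => gotzmann_sum b' d.+1 <= D d)%N).
    by have := Hexact e (leqnn e); have := diff e me; lia.
  move=> j je; apply: macaulay_quotient => // i f ib [q qA Jq].
  exists ('X_i * q); first exact: inA_mulX.
  by have := zero_on_mul 'X_i Jq; rewrite mulrBr mulrCA.
suff : (m <= m -> H m <= gotzmann_sum s m)%N by apply.
apply: (downward_induction (Q := fun d => m <= d -> H d <= gotzmann_sum s d)%N) me.
  by rewrite He.
move=> j je IH mj; have := IH (leqW mj); have := diff j mj.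
by have := Hexact j (ltnW je); have := low j (ltnW je); lia.
Qed.

(** Gotzmann's regularity theorem, for the Hilbert function of a reduced
    scheme. *)
Theorem hilbert_function_eq_polynomial P g m e :
  hilbert_polynomial a b (zero_on Y) P -> gotzmann_number P g -> (g <= m)%N ->
  quotient_basis a b m (zero_on Y) e -> (size e)%:R = P.[m%:R].
Proof.
move=> [m0 hP] hg gm he; have [s [ss sg Ps]] := gotzmann_eval hg.
have linJ := zero_on_subspace Y.
have szH d e' : quotient_basis a b d (zero_on Y) e' -> size e' = H d.
  by move=> h; exact: (monomial_basis_card linJ h (standard_basis a b d linJ)).
rewrite (szH _ _ he) Ps //; congr (_%:R).
have big d : (m0 <= d)%N -> (g <= d)%N -> H d = gotzmann_sum s d.
  move=> md gd; have [e' /szH he' Pe'] := hP d md.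
  by apply/eqP; rewrite -(eqr_nat rat) -Ps // Pe' he'.
pose N := (m0 + m)%N.
apply/eqP; rewrite eqn_leq; apply/andP; split.
  apply: (@hilbert_upper s N) => //; rewrite ?sg //; try (apply: big); rewrite /N; lia.
apply: (@hilbert_lower s N) => //; last by rewrite /N; lia.
by rewrite big // /N; lia.
Qed.

End RegularityTheorem.

(** * The index as a minimum of total weights *)

Lemma finite_min (E : rat -> Prop) (s : seq rat) :
  (forall x, E x -> x \in s) -> (exists x, E x) ->
  exists2 x, E x & forall y, E y -> x <= y.
Proof.
elim: s E => [|x0 s IH] E Es [x1 Ex1]; first by have := Es _ Ex1.
have [[x2 [Ex2 x20]]|none] := classic (exists x, E x /\ x != x0); last first.
  exists x1 => // y Ey; have [yx|/eqP yx] := eqVneq y x1; first by rewrite yx.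
  have eq0 z : E z -> z = x0.
    by move=> Ez; apply/eqP/negP => /negP zx; apply: none; exists z.
  by rewrite (eq0 _ Ex1) (eq0 _ Ey).
have [||x [Ex xx0] xmin] := IH (fun x => E x /\ x != x0).
- by move=> x [/Es]; rewrite inE => /orP[->|].
- by exists x2.
have [Ex0|nEx0] := classic (E x0); last first.
  by exists x => // y Ey; apply: xmin; split=> //; apply/eqP=> y0; rewrite y0 in Ey.
have [le|lt] := leP x0 x.
  exists x0 => // y Ey; have [->//|y0] := eqVneq y x0.
  by apply: le_trans le _; apply: xmin.
exists x => // y Ey; have [->|y0] := eqVneq y x0; first exact: ltW.
exact: xmin.
Qed.

Section Index.
Variables (k : closedFieldType) (n : nat).
Local Notation S := {mpoly k[n.+1]}.
Local Notation mon := 'X_{1..n.+1}.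
Local Notation pt := 'rV[k]_n.+1.
Implicit Types (J : S -> Prop) (u : mon) (r : 'I_n.+1 -> int).

Definition weight r u : rat := \sum_i (u i)%:R * (r i)%:~R.
Definition total_weight r (B : seq mon) : rat := \sum_(u <- B) weight r u.

Lemma normalized_weight a b m r u : u \in monomials a b m ->
  \sum_(i < n.+1 | (a <= i <= b)%N) (u i)%:R * ((r i)%:~R - mean_weight a b r)
  = weight r u - m%:R * mean_weight a b r.
Proof.
rewrite mem_monomials => /andP[/eqP <- /insideP iu].
have out (i : 'I_n.+1) : ~~ (a <= i <= b)%N -> u i = 0%N.
  by apply: contraNeq => /iu.
under eq_bigr do rewrite mulrBr.
rewrite sumrB -mulr_suml mdegE natr_sum; congr (_ - _ * _).
  rewrite big_mkcond; apply: eq_bigr => i _.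
  by case: ifP => // /negbT /out ->; rewrite mul0r.
rewrite big_mkcond; apply: eq_bigr => i _.
by case: ifP => // /negbT /out ->.
Qed.

(** All the monomials of a basis have degree [m], so normalising the weights
    shifts the weight of each by the same amount. *)
Lemma state_weightP a b m J J' r w : subspace J ->
  (forall f, inA a b m f -> (J' f <-> J f)) ->
  state_weight a b m J' r w <-> exists2 B, monomial_basis a b m J B &
    w = - total_weight r B + m%:R * (size B)%:R * mean_weight a b r.
Proof.
move=> linJ ext.
have weq B : {subset B <= monomials a b m} ->
    - (\sum_(al <- B) \sum_(i < n.+1 | (a <= i <= b)%N)
         (al i)%:R * ((r i)%:~R - mean_weight a b r)) =
    - total_weight r B + m%:R * (size B)%:R * mean_weight a b r.
  move=> sB; rewrite big_seq.
  under eq_bigr => u uB do rewrite (normalized_weight r (sB _ uB)).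
  rewrite -big_seq sumrB opprB addrC; congr (- _ + _).
  rewrite big_const_seq count_predT iter_addr_0 -mulr_natr; ring.
split=> [[B hB ->]|[B hB ->]].
  have {}hB : monomial_basis a b m J B.
    by apply/(monomial_basisP _ _ _ _ linJ.1); apply: quotient_basis_ext hB.
  by exists B => //; apply: weq; have [] := hB.
exists B; last by rewrite weq //; have [] := hB.
apply: (quotient_basis_ext (J := J)) => [f fA|]; first by split=> /ext; apply.
exact/(monomial_basisP _ _ _ _ linJ.1).
Qed.

Lemma monomial_basis_size a b m J B B' : subspace J ->
  monomial_basis a b m J B -> monomial_basis a b m J B' -> size B = size B'.
Proof.
move=> linJ hB hB'; rewrite -(size_map (fun u => 'X_[u] : S) B).
by apply: (monomial_basis_card linJ) hB'; apply/(monomial_basisP _ _ _ _ linJ.1).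
Qed.

Definition lightest a b m J r B :=
  monomial_basis a b m J B /\
  forall B', monomial_basis a b m J B' -> total_weight r B <= total_weight r B'.

(** A basis is a subset of the finite set of monomials of degree [m], so there
    are finitely many total weights and a lightest basis exists; its state
    attains the maximum that the index selects. *)
Lemma hm_index_lightest a b m J J' r : subspace J ->
  (forall f, inA a b m f -> (J' f <-> J f)) ->
  exists2 B, lightest a b m J r B &
    hm_index a b m J' r = - total_weight r B + m%:R * (size B)%:R * mean_weight a b r.
Proof.
move=> linJ ext.
pose E x := exists2 B, monomial_basis a b m J B & x = total_weight r B.
pose vals := [seq total_weight r (mask t (monomials a b m))
  | t : (size (monomials (n := n) a b m)).-tuple bool].
have [||x [B hB ->] xmin] := @finite_min E vals.
- move=> _ [B [uB sB _ _] ->].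
  pose M := monomials (n := n) a b m; pose t := map_tuple (mem B) (in_tuple M).
  suff -> : total_weight r B = total_weight r (mask t M) by apply: image_f.
  rewrite /= -filter_mask; apply: perm_big; apply: uniq_perm => //.
    by apply: filter_uniq; apply: monomials_uniq.
  by move=> u; rewrite mem_filter; apply/idP/andP => [uB'|[]//]; split=> //; apply: sB.
- exists (total_weight r (standard a b m J)), (standard a b m J) => //.
  exact: standard_basis.
exists B; first by split=> // B' hB'; apply: xmin; exists B'.
have hmax : is_max (state_weight a b m J' r)
    (- total_weight r B + m%:R * (size B)%:R * mean_weight a b r).
  split; first by apply/(state_weightP _ _ linJ ext); exists B.
  move=> y /(state_weightP _ _ linJ ext)[B' hB' ->].
  rewrite (monomial_basis_size linJ hB hB') lerD2r lerN2.
  by apply: xmin; exists B'.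
have [h1 h2] := epsilon_spec (inhabits 0) _ (ex_intro _ _ hmax).
by apply/le_anti; rewrite h2 ?hmax.2 //; case: hmax.
Qed.

Lemma vanishing_zero_on a b d (Y : pt -> Prop) (f : S) : inA a b d f ->
  (vanishing_ideal Y f <-> zero_on Y f).
Proof.
move=> /inAP[hf _]; split=> [h v Yv|h d' v Yv].
  by have := h d v Yv; rewrite pihomog_dE.
have [<-|ne] := eqVneq d d'; first by rewrite pihomog_dE // h.
by rewrite (pihomog_ne0 ne hf) meval0.
Qed.

End Index.

(** * Glueing monomial bases along a chain *)

Section Chain.
Variables (k : closedFieldType) (n l : nat).
Local Notation S := {mpoly k[n.+1]}.
Local Notation mon := 'X_{1..n.+1}.
Local Notation pt := 'rV[k]_n.+1.
Variables (X : 'I_l -> pt -> Prop) (ns : nat -> nat).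
Hypothesis X_neq0 : forall i v, X i v -> v != 0.
Hypothesis X_meet : forall i j : 'I_l, j = i.+1 :> nat -> exists v, X i v /\ X j v.
Hypothesis nsl : ns l = n.
Hypothesis ns_incr : forall i : nat, (i < l)%N -> (ns i < ns i.+1)%N.
Hypothesis X_sub : forall (i : 'I_l) (v : pt), X i v ->
  forall j : 'I_n.+1, (j < ns i)%N || (ns i.+1 < j)%N -> v ord0 j = 0.
Variable m : nat.
Hypothesis m_gt0 : (0 < m)%N.
Implicit Types (u : mon) (i : 'I_l) (f : S).

Definition whole (v : pt) := exists i, X i v.

Let on i u := inside (ns i) (ns i.+1) u.
Let A i := monomials (n := n) (ns i) (ns i.+1) m.
Let J i := zero_on (X i).

Lemma ns_leq (i j : nat) : (i <= j)%N -> (j <= l)%N -> (ns i <= ns j)%N.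
Proof.
elim: j => [|j IH]; first by rewrite leqn0 => /eqP->.
rewrite leq_eqVlt => /orP[/eqP->//|ij] jl.
exact: leq_trans (IH ij (ltnW jl)) (ltnW (ns_incr jl)).
Qed.

Lemma ns_lt (i j : nat) : (i < j)%N -> (j <= l)%N -> (ns i < ns j)%N.
Proof.
by move=> ij jl; apply: leq_trans (ns_leq ij jl); apply: ns_incr; apply: leq_trans ij jl.
Qed.

Lemma node_val (i : nat) : (i <= l)%N -> (inord (ns i) : 'I_n.+1) = ns i :> nat.
Proof. by move=> il; rewrite inordK // ltnS -nsl ns_leq. Qed.

Definition node (i : nat) : mon := (U_(inord (ns i)) *+ m)%MM.

Lemma monomials_sub i : {subset A i <= monomials 0 n m}.
Proof.
move=> u; rewrite !mem_monomials => /andP[-> _]; apply/insideP=> j _ /=.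
by rewrite -ltnS.
Qed.

Lemma mem_A i u : (u \in A i) = (u \in monomials 0 n m) && on i u.
Proof.
apply/idP/andP => [uA|[]]; last by rewrite !mem_monomials => /andP[-> _].
by rewrite (monomials_sub uA); move: uA; rewrite mem_monomials => /andP[].
Qed.

Lemma meval_off i v u : X i v -> ~~ on i u -> ('X_[u] : S).@[v ord0] = 0.
Proof.
move=> Xv /forallPn[j]; rewrite negb_imply => /andP[uj out].
rewrite mevalX (bigD1 j) //= (X_sub Xv); last by move: out; lia.
by rewrite expr0n (negbTE uj) mul0r.
Qed.

Lemma meval_restrict i v (B : seq mon) (c : mon -> k) : X i v ->
  (\sum_(u <- B) c u *: 'X_[u] : S).@[v ord0] =
  (\sum_(u <- [seq u <- B | on i u]) c u *: 'X_[u] : S).@[v ord0].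
Proof.
move=> Xv; rewrite !raddf_sum /= big_filter [RHS]big_mkcond; apply: eq_bigr => u _.
by case: ifP => // /negbT off; rewrite mevalZ (meval_off Xv off) mulr0.
Qed.

(** Consecutive intervals share one index and the others are disjoint. *)
Lemma on_two u i i' : u \in monomials 0 n m -> (i < i')%N -> on i u -> on i' u ->
  i' = i.+1 :> nat /\ u = node i'.
Proof.
rewrite mem_monomials => /andP[/eqP du _] ii' /insideP oi /insideP oi'.
have [j uj] : exists j, u j != 0%N.
  apply/existsP; apply: contraLR m_gt0; rewrite negb_exists => /forallP h.
  rewrite -eqn0Ngt -du mdegE big1 // => j _; apply/eqP.
  by have := h j; rewrite negbK.
have i'l := ltn_ord i'.
have Ei : i' = i.+1 :> nat.
  apply/eqP; rewrite eqn_leq ii' andbT leqNgt; apply/negP => lt.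
  by have := ns_lt lt (ltnW i'l); have := oi j uj; have := oi' j uj; lia.
split=> //.
have only j' : u j' != 0%N -> j' = inord (ns i').
  move=> uj'; apply: val_inj; rewrite /= node_val ?(ltnW i'l) //.
  by have := oi j' uj'; have := oi' j' uj'; rewrite Ei; lia.
apply/mnmP=> j'; rewrite mulmnE mnm1E; have [<-|ne] := eqVneq.
  rewrite mul1n -du mdegE (bigD1 (inord (ns i'))) //= big1 ?addn0 // => j'' ne.
  by apply/eqP; apply: contraNT ne => /only ->.
by rewrite mul0n; apply/eqP; apply: contraNT ne => /only ->.
Qed.

Lemma node_monomials i : node i \in monomials 0 n m.
Proof.
rewrite mem_monomials mdegMn mdeg1 mul1n eqxx; apply/insideP=> j _ /=.
by rewrite -ltnS.
Qed.

Lemma node_on i i' : i' = i.+1 :> nat -> on i (node i') /\ on i' (node i').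
Proof.
move=> Ei; have i'l := ltn_ord i'.
have h j : node i' j != 0%N -> j = ns i' :> nat.
  rewrite mulmnE mnm1E; have [<-|_] := eqVneq (inord (ns i')) j; last by rewrite mul0n.
  by rewrite node_val // ltnW.
have := ns_incr (ltn_ord i); have := ns_incr i'l; rewrite Ei => lt' lt.
by split; apply/insideP => j; rewrite -?Ei => /h ->; rewrite Ei; lia.
Qed.

(** Evaluate at a common point of the two components: all its coordinates but
    the one of the node are zero. *)
Lemma node_coef i i' f : i' = i.+1 :> nat -> inA 0 n m f ->
  (J i f \/ J i' f) -> f@_(node i') = 0.
Proof.
move=> Ei fA Jf; have [v [Xv Xv']] := X_meet Ei; have i'l := ltn_ord i'.
set p : 'I_n.+1 := inord (ns i').
have vp : p = ns i' :> nat by rewrite node_val // ltnW.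
have off j : j != p -> v ord0 j = 0.
  rewrite -val_eqE /= vp => jp.
  have [lt|le] := ltnP j (ns i'); first by rewrite (X_sub Xv') ?lt.
  by rewrite (X_sub Xv) // -Ei; apply/orP; right; lia.
have v0 : v ord0 p != 0.
  apply: contra (X_neq0 Xv) => /eqP vp0; apply/eqP/rowP => j; rewrite mxE.
  by have [->|/off] := eqVneq j p.
have : f.@[v ord0] = 0 by case: Jf => h; apply: h.
rewrite {1}(inA_comb_monomials fA) raddf_sum /=.
rewrite (bigD1_seq (node i')) ?node_monomials ?monomials_uniq //=.
rewrite big1_seq ?addr0 => [|u /andP[ne uM]].
  move/eqP; rewrite mevalZ mevalX (bigD1 p) //= big1 => [|j jp].
    by rewrite mulr1 mulf_eq0 expf_eq0 (negbTE v0) andbF orbF => /eqP.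
  by rewrite mulmnE mnm1E eq_sym (negbTE jp) mul0n expr0.
rewrite mevalZ; have [j jp uj] : exists2 j, j != p & u j != 0%N.
  apply: NNPP => none; case/negP: ne; apply/eqP/mnmP=> j.
  have z j' : j' != p -> u j' = 0%N.
    by move=> jp; apply/eqP; apply: contraT => uj; case: none; exists j'.
  rewrite mulmnE mnm1E -/p; have [<-|pj] := eqVneq p j; last by rewrite z 1?eq_sym.
  move: uM; rewrite mem_monomials => /andP[/eqP <- _].
  by rewrite mul1n mdegE (bigD1 p) //= big1 ?addn0 // => j' /z.
by rewrite mevalX (bigD1 j) //= off // expr0n (negbTE uj) mul0r mulr0.
Qed.

Lemma shared_coef i i' u f : i' != i -> on i u -> on i' u -> u \in monomials 0 n m ->
  inA 0 n m f -> J i f -> f@_u = 0.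
Proof.
move=> ne oi oi' uM fA Jf; have := ne; rewrite -val_eqE /= neq_ltn => /orP[lt|lt].
  have [E ->] := on_two uM lt oi' oi.
  by apply: (node_coef E fA); right.
have [E ->] := on_two uM lt oi oi'.
by apply: (node_coef E fA); left.
Qed.

Lemma inA_whole i f : inA (ns i) (ns i.+1) m f -> inA 0 n m f.
Proof. by move=> fA u /fA; apply: monomials_sub. Qed.

(** The relation that expresses a shared monomial in a basis of the component
    has coefficient zero at this monomial, which therefore belongs to the
    basis. *)
Lemma shared_mem i i' u B : i' != i -> on i u -> on i' u -> u \in monomials 0 n m ->
  monomial_basis (ns i) (ns i.+1) m (J i) B -> u \in B.
Proof.
move=> ne oi oi' uM [uB sB _ sp].
have uA : inA (ns i) (ns i.+1) m ('X_[u] : S) by apply: inA_mon; rewrite -/(A i) mem_A uM.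
have [c Jc] := sp _ uA.
have linA := inA_subspace (k := k) (n := n) 0 n m.
have fA : inA 0 n m ('X_[u] - \sum_(u <- B) c u *: 'X_[u] : S).
  apply: (subspaceB linA); first exact: inA_whole uA.
  by apply: inA_comb => w /sB; apply: monomials_sub.
have := shared_coef ne oi oi' uM fA Jc.
rewrite mcoeffB mcoeffX eqxx mcoeff_comb //; case: ifP => // _.
by move/eqP; rewrite subr0 oner_eq0.
Qed.

(** A relation on [X i] among the monomials of the [i]-th interval involves no
    shared node power, and its other monomials vanish on the other components; hence it is
    a relation on the whole chain. *)
Lemma monomial_basis_restrict B i : monomial_basis 0 n m (zero_on whole) B ->
  monomial_basis (ns i) (ns i.+1) m (J i) [seq u <- B | on i u].
Proof.
move=> [uB sB fr sp]; split.
- exact: filter_uniq.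
- by move=> u; rewrite mem_filter -/(A i) mem_A => /andP[-> /sB ->].
- set Bi := [seq u <- B | on i u] => c Jc u uBi.
  have sBi : {subset Bi <= monomials 0 n m} by move=> w; rewrite mem_filter => /andP[_ /sB].
  have fA := inA_comb (k := k) (c := c) sBi.
  have zero : zero_on whole (\sum_(u <- Bi) c u *: 'X_[u] : S).
    move=> v [i' Xv]; have [E|ne] := eqVneq i' i; first by apply: Jc; rewrite -E.
    rewrite raddf_sum /= big1_seq // => w /andP[_ wB].
    have [oi'|off] := boolP (on i' w); last by rewrite mevalZ (meval_off Xv off) mulr0.
    have := wB; rewrite mem_filter => /andP[oi _].
    have := shared_coef ne oi oi' (sBi _ wB) fA Jc.
    by rewrite mcoeff_comb ?filter_uniq // wB => ->; rewrite scale0r meval0.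
  have := uBi; rewrite mem_filter => /andP[oi uB'].
  have := fr (fun u => if on i u then c u else 0) _ u uB'; rewrite oi; apply.
  move: zero; rewrite big_filter big_mkcond; congr zero_on; apply: eq_bigr => w _.
  by case: ifP; rewrite ?scale0r.
- move=> f fA; have [c Jc] := sp f (inA_whole fA).
  exists c => v Xv; have := Jc v (ex_intro _ i Xv).
  by rewrite !mevalB (meval_restrict _ _ Xv).
Qed.

(** Independence and generation are checked on each component, where only the
    monomials of its interval count.  Generation needs the coefficients chosen
    on neighbouring components to agree at the node power: both are the
    coefficient of the node power in the given polynomial. *)
Lemma monomial_basis_glue (Bs : 'I_l -> seq mon) :
  (forall i, monomial_basis (ns i) (ns i.+1) m (J i) (Bs i)) ->
  exists2 B, monomial_basis 0 n m (zero_on whole) B &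
    forall i, perm_eq [seq u <- B | on i u] (Bs i).
Proof.
move=> hB; pose B := [seq u <- monomials 0 n m | [exists i, u \in Bs i]].
have uB : uniq B by apply: filter_uniq; apply: monomials_uniq.
have Bs_on i u : u \in Bs i -> (u \in monomials 0 n m) && on i u.
  by have [_ sB _ _] := hB i; move/sB; rewrite -/(A i) mem_A.
have mem_B u : (u \in B) = [exists i, u \in Bs i].
  by rewrite mem_filter; apply: andb_idr => /existsP[i /Bs_on/andP[]].
have perm i : perm_eq [seq u <- B | on i u] (Bs i).
  have [uBi _ _ _] := hB i; apply: uniq_perm => //; first exact: filter_uniq.
  move=> u; rewrite mem_filter mem_B; apply/andP/idP => [[oi /existsP[i' ui']]|ui].
    have /andP[uM oi'] := Bs_on _ _ ui'.
    have [<-//|ne] := eqVneq i' i.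
    exact: shared_mem ne oi oi' uM (hB i).
  by have /andP[_ ->] := Bs_on _ _ ui; split=> //; apply/existsP; exists i.
exists B => //; split=> //; first by move=> u; rewrite mem_filter => /andP[].
  move=> c Jc u; rewrite mem_B => /existsP[i ui].
  have [_ _ fr _] := hB i; apply: fr ui => v Xv.
  have := Jc v (ex_intro _ i Xv); rewrite (meval_restrict _ _ Xv).
  by rewrite (perm_big _ (perm i)).
move=> f fA.
pose fi i := \sum_(u <- A i) f@_u *: ('X_[u] : S).
have fiA i : inA (ns i) (ns i.+1) m (fi i) by apply: inA_comb.
have fiE i v : X i v -> f.@[v ord0] = (fi i).@[v ord0].
  move=> Xv; rewrite {1}(inA_comb_monomials fA) (meval_restrict _ _ Xv).
  congr (meval _ _); apply: perm_big; apply: uniq_perm.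
  - by apply: filter_uniq; apply: monomials_uniq.
  - exact: monomials_uniq.
  - move=> u; by rewrite mem_filter mem_A andbC.
have [c Jc] : exists c : 'I_l -> mon -> k, forall i,
    J i (fi i - \sum_(u <- Bs i) c i u *: 'X_[u]).
  by apply: (fin_all_exists (P := fun i c => J i (fi i - \sum_(u <- Bs i) c u *: 'X_[u])))
    => i; have [_ _ _ sp] := hB i; apply: sp.
have linA := inA_subspace (k := k) (n := n) 0 n m.
have shared i i' u : i' != i -> u \in Bs i -> on i' u -> c i u = f@_u.
  move=> ne ui oi'; have /andP[uM oi] := Bs_on _ _ ui.
  have gA : inA 0 n m (fi i - \sum_(u <- Bs i) c i u *: 'X_[u]).
    apply: (subspaceB linA); first exact: inA_whole (fiA i).
    by apply: inA_comb => w /Bs_on/andP[].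
  have [uBi _ _ _] := hB i.
  have := shared_coef ne oi oi' uM gA (Jc i).
  rewrite mcoeffB !mcoeff_comb ?monomials_uniq // ui mem_A uM oi.
  by move/eqP; rewrite subr_eq0 => /eqP ->.
pose d u := if [pick i | on i u] is Some i then c i u else 0.
have dE i u : u \in Bs i -> d u = c i u.
  move=> ui; have /andP[uM oi] := Bs_on _ _ ui; rewrite /d.
  case: pickP => [i' oi'|/(_ i)]; last by rewrite oi.
  have [->//|ne] := eqVneq i' i.
  have ui' : u \in Bs i' by apply: (shared_mem _ oi' oi uM (hB i')); rewrite eq_sym.
  by rewrite (shared _ _ _ ne ui oi') (shared i' i) // eq_sym.
exists d => v [i Xv]; have := Jc i v Xv; rewrite !mevalB (fiE _ _ Xv) => <-.
rewrite (meval_restrict _ _ Xv) (perm_big _ (perm i)) /=; congr (_ - meval _ _).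
by apply: eq_big_seq => u /dE ->.
Qed.

(** Each monomial of [B] is attributed to the first interval that contains its
    support; what is left on the [i]-th interval is the node power it shares
    with the previous one. *)
Lemma total_weight_restrict r B : monomial_basis 0 n m (zero_on whole) B ->
  \sum_(i < l) total_weight r [seq u <- B | on i u] =
  total_weight r B + m%:R * \sum_(1 <= i < l) (r (inord (ns i)))%:~R.
Proof.
move=> hB; have [uB sB fr sp] := hB.
(* the first interval containing the support is the only fresh one *)
pose fresh i u := on i u && ~~ ((0 < i)%N && (u == node i)).
have nodeB i : (0 < i)%N -> node i \in B /\ on i (node i).
  case: i => -[//|i] il _; pose i0 := Ordinal (ltnW il); pose i1 := Ordinal il.
  have [o0 o1] := @node_on i0 i1 erefl; split=> //.
  have := shared_mem (i := i1) (i' := i0) _ o1 o0 (node_monomials i1)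
    (monomial_basis_restrict i1 hB).
  rewrite mem_filter -val_eqE /= neq_ltn ltnSn => /(_ isT).
  by case/andP.
have split i : total_weight r [seq u <- B | on i u] =
    \sum_(u <- B | fresh i u) weight r u
    + (if (0 < i)%N then m%:R * (r (inord (ns i)))%:~R else 0).
  rewrite /total_weight big_filter (bigID (fun u => (0 < i)%N && (u == node i))) /= addrC.
  congr (_ + _); case: ifP => [i0|_]; last by rewrite big_pred0 // => u; rewrite andbF.
  have [nB on_i] := nodeB i i0.
  rewrite -big_filter (_ : filter _ B = [:: node i]) ?big_seq1.
    rewrite /weight (bigD1 (inord (ns i))) //= big1 ?addr0 => [|j ji].
      by rewrite mulmnE mnm1E eqxx mul1n.
    by rewrite mulmnE mnm1E eq_sym (negbTE ji) mul0n mul0r.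
  rewrite -[RHS](filter_pred1_uniq uB nB); apply: eq_filter => u /=.
  by case: eqP => [->|_]; rewrite ?andbF // on_i.
rewrite (eq_bigr _ (fun i _ => split i)) big_split /=; congr (_ + _).
  rewrite (exchange_big_dep predT) //= /total_weight; apply: eq_big_seq => u uB'.
  have uM := sB _ uB'.
  have [i0 oi0] : exists i, on i u.
    apply: NNPP => none.
    suff /fr /(_ u uB') /eqP : zero_on whole (\sum_(w <- B) (w == u)%:R *: 'X_[w] : S).
      by rewrite eqxx oner_eq0.
    move=> v [i Xv]; rewrite (bigD1_seq u) //= eqxx scale1r big1 ?addr0.
      by apply: (meval_off Xv); apply/negP => oi; apply: none; exists i.
    by move=> w /negbTE->; rewrite scale0r.
  case: (@arg_minnP _ i0 (fun i => on i u) (fun i => val i) oi0) => i oi imin.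
  rewrite (big_pred1 i) // => i' /=; apply/idP/eqP => [/andP[oi' new]|->].
    apply: contraNeq new => ne.
    have lt : (i < i')%N by rewrite ltn_neqAle imin // andbT eq_sym val_eqE.
    have [E ->] := on_two uM lt oi oi'; rewrite eqxx andbT; lia.
  rewrite /fresh oi /=; apply/negP => /andP[ipos /eqP un].
  case: i ipos un imin {oi} => -[//|i] il _ un imin.
  have := imin (Ordinal (ltnW il)); rewrite un.
  have [-> _] := @node_on (Ordinal (ltnW il)) (Ordinal il) erefl.
  by move=> /(_ isT) /=; lia.
rewrite mulr_sumr.
rewrite -(big_mkord xpredT
  (fun i : nat => if (0 < i)%N then m%:R * (r (inord (ns i)))%:~R else 0)).
case: (l) => [|l']; first by rewrite !big_geq.
by rewrite big_ltn // add0r; apply: eq_big_nat => i /andP[-> _].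
Qed.

End Chain.

(** * The index of a chain *)
Theorem proposition1p3
  (k : closedFieldType) (char0 : [pchar k] =i pred0)
  (n l : nat) (l_gt0 : (0 < l)%N)
  (X : 'I_l -> 'rV[k]_n.+1 -> Prop)
  (X_var : forall i, projective_variety (X i))
  (X_chain : forall i j : 'I_l, i != j ->
     ((exists v, X i v /\ X j v) <-> (j = i.+1 :> nat \/ i = j.+1 :> nat)))
  (ns : nat -> nat)
  (ns0 : ns 0%N = 0%N) (nsl : ns l = n)
  (ns_incr : forall i : nat, (i < l)%N -> (ns i < ns i.+1)%N)
  (X_sub : forall (i : 'I_l) (v : 'rV[k]_n.+1), X i v ->
     forall j : 'I_n.+1, (j < ns i)%N || (ns i.+1 < j)%N -> v ord0 j = 0)
  (r : 'I_n.+1 -> int)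
  (P : {poly rat}) (hP : hilbert_polynomial 0 n (union_ideal X) P)
  (Pi : 'I_l -> {poly rat})
  (hPi : forall i : 'I_l,
     hilbert_polynomial (ns i) (ns i.+1)
       (contraction (ns i) (ns i.+1) (vanishing_ideal (X i))) (Pi i))
  (g : nat) (hg : gotzmann_number P g)
  (gi : 'I_l -> nat) (hgi : forall i, gotzmann_number (Pi i) (gi i))
  (m : nat) (m_ge : (g <= m)%N) (m_gei : forall i, (gi i <= m)%N) :
  hm_index 0 n m (union_ideal X) r =
    \sum_(i < l) hm_index (ns i) (ns i.+1) m
                      (contraction (ns i) (ns i.+1) (vanishing_ideal (X i))) r
    - \sum_(i < l)
        (m%:R * (Pi i).[m%:R] / (ns i.+1 - ns i + 1)%:R
         * \sum_(j < n.+1 | (ns i <= j <= ns i.+1)%N) (r j)%:~R)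
    + m%:R * P.[m%:R] / (n.+1)%:R * \sum_(i < n.+1) (r i)%:~R
    + m%:R * \sum_(1 <= i < l) (r (inord (ns i)))%:~R.
Proof.
have X_neq0 i v : X i v -> v != 0.
  by have [[T [_ h]] _] := X_var i; case/h.
have X_meet (i j : 'I_l) : j = i.+1 :> nat -> exists v, X i v /\ X j v.
  move=> Ej; have ne : i != j by rewrite -val_eqE /= Ej; lia.
  by have [_ h] := X_chain _ _ ne; apply: h; left.
pose Y := whole X.
have supY : supported 0 n Y.
  by move=> v [i Xv]; split=> [|j]; [exact: X_neq0 Xv | rewrite leq_ord].
have supX (i : 'I_l) : supported (ns i) (ns i.+1) (X i).
  move=> v Xv; split=> [|j out]; first exact: X_neq0 Xv.
  by apply: (X_sub _ _ Xv); move: out; lia.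
have extY d f : inA 0 n d f -> (union_ideal X f <-> zero_on Y f).
  move=> fA; split=> [h v [i Xv]|h i].
    by have /(vanishing_zero_on _ fA) := h i; apply.
  by apply/(vanishing_zero_on _ fA) => v Xv; apply: h; exists i.
have extX (i : 'I_l) d f : inA (ns i) (ns i.+1) d f ->
    (contraction (ns i) (ns i.+1) (vanishing_ideal (X i)) f <-> zero_on (X i) f).
  move=> fA; rewrite -(vanishing_zero_on (X i) fA).
  by split=> [[]//|h]; split=> //; have /inAP[] := fA.
have hP' : hilbert_polynomial 0 n (zero_on Y) P.
  have [m0 h] := hP; exists m0 => d /h[e he Pe]; exists e => //.
  by apply: quotient_basis_ext he; apply: extY.
have hPi' (i : 'I_l) : hilbert_polynomial (ns i) (ns i.+1) (zero_on (X i)) (Pi i).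
  have [m0 h] := hPi i; exists m0 => d /h[e he Pe]; exists e => //.
  by apply: quotient_basis_ext he; apply: extX.
(* a polynomial with Gotzmann number 0 is 0, but the components are nonempty *)
have m_gt0 : (0 < m)%N.
  rewrite lt0n; apply/negP => /eqP m0; move: m_ge; rewrite m0 leqn0 => /eqP g0.
  have [s [E _ P0]] := hg; rewrite g0 in P0.
  have [d0 h] := hP'; have [e [h1 h2 h3]] := h d0 (leqnn _).
  rewrite P0 big_ord0 horner0 => /eqP.
  rewrite eq_sym pnatr_eq0 size_eq0 => /eqP e0; subst e.
  have [v Xv] := (X_var (Ordinal l_gt0)).2.
  have [j vj] : exists j, v ord0 j != 0.
    apply/existsP; apply: contraT; rewrite negb_exists => /forallP v0.
    case/negP: (X_neq0 _ _ Xv); apply/eqP/rowP => j; rewrite mxE.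
    by have := v0 j; rewrite negbK => /eqP.
  pose f : {mpoly k[n.+1]} := 'X_[U_(j) *+ d0].
  have /inAP[fh fs] : inA 0 n d0 f.
    apply: inA_mon; rewrite mem_monomials mdegMn mdeg1 mul1n eqxx; apply/insideP => j' _ /=.
    by rewrite -ltnS.
  have [c] := h3 f fh fs; rewrite big_ord0 subr0 => /(_ v).
  move=> /(_ (ex_intro _ _ Xv)) /eqP; rewrite /f -mpolyXn rmorphXn /= mevalXU.
  by rewrite expf_eq0 (negbTE vj) andbF.
have [B [hB Bmin] ->] := hm_index_lightest r (zero_on_subspace Y) (extY m).
have [Bs hBs hmu] := fin_all_exists2
  (fun i : 'I_l => hm_index_lightest r (zero_on_subspace (X i)) (extX i m)).
have szB : (size B)%:R = P.[m%:R].
  rewrite -(size_map (fun u => 'X_[u] : {mpoly k[n.+1]})).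
  apply: (hilbert_function_eq_polynomial supY hP' hg m_ge).
  by apply/monomial_basisP => //; case: (zero_on_subspace Y).
have szBs i : (size (Bs i))%:R = (Pi i).[m%:R].
  rewrite -(size_map (fun u => 'X_[u] : {mpoly k[n.+1]})).
  apply: (hilbert_function_eq_polynomial (supX i) (hPi' i) (hgi i) (m_gei i)).
  by apply/monomial_basisP; [case: (zero_on_subspace (X i)) | exact: (hBs i).1].
set R := m%:R * \sum_(1 <= i < l) (r (inord (ns i)))%:~R.
have restr := total_weight_restrict X_neq0 X_meet nsl ns_incr X_sub m_gt0 r.
(* lightest bases glue to, and restrict from, bases of the chain *)
have tot : total_weight r B = \sum_(i < l) total_weight r (Bs i) - R.
  apply/le_anti/andP; split.
    have [B' hB' perm] := monomial_basis_glue X_neq0 X_meet nsl ns_incr X_sub m_gt0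
      (fun i => (hBs i).1).
    apply: le_trans (Bmin _ hB') _; rewrite lerBrDr -(restr _ hB').
    by apply: ler_sum => i _; rewrite /total_weight (perm_big _ (perm i)).
  rewrite lerBlDr -(restr _ hB); apply: ler_sum => i _.
  apply: (hBs i).2.
  by apply: (monomial_basis_restrict X_neq0 X_meet nsl ns_incr X_sub m_gt0 i hB).
rewrite tot szB; under [X in _ = X - _ + _ + _]eq_bigr => i _ do rewrite hmu szBs.
rewrite big_split sumrN /= opprB.
have -> : \sum_(i < l) m%:R * (Pi i).[m%:R] * mean_weight (ns i) (ns i.+1) r =
   \sum_(i < l) (m%:R * (Pi i).[m%:R] / (ns i.+1 - ns i + 1)%:R
         * \sum_(j < n.+1 | (ns i <= j <= ns i.+1)%N) (r j)%:~R).
  by apply: eq_bigr => i _; rewrite /mean_weight mulrA mulrAC.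
have -> : m%:R * P.[m%:R] * mean_weight 0 n r =
    m%:R * P.[m%:R] / (n.+1)%:R * \sum_(i < n.+1) (r i)%:~R.
  rewrite /mean_weight subn0 addn1 (eq_bigl predT) => [|i]; last by rewrite /= leq_ord.
  by rewrite mulrA mulrAC.
ring.
Qed.
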